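(* Let $\mathcal{K}\subset\mathbb{R}^n$ and $\mathcal{V}\subset\mathbb{R}^m$ be closed convex sets, and let $L:\mathbb{R}^n\times\mathbb{R}^m\to\mathbb{R}$ be continuously differentiable, with $L(\cdot,y)$ convex for every $y$ and $L(x,\cdot)$ concave for every $x$. Assume there exists at least one saddle point $(x^*,y^* )\in\mathcal{K}\times\mathcal{V}$ of $L$, i.e. $L(x^*,y)\le L(x^*,y^* )\le L(x,y^* )$ for all $x\in\mathcal{K}$, $y\in\mathcal{V}$. Fix $\rho>0$ and consider the projected regularized saddle flow dynamics \[ \dot x=\Pi_{\mathcal{K}}\Big[x,\,-\nabla_xL(x,y)-\tfrac{1}{\rho}(x-z)\Big],\qquad \dot z=\Pi_{\mathcal{K}}\Big[z,\,\tfrac{1}{\rho}(x-z)\Big], \] \[ \dot y=\Pi_{\mathcal{V}}\Big[y,\,\nabla_yL(x,y)-\tfrac{1}{\rho}(y-w)\Big],\qquad \dot w=\Pi_{\mathcal{V}}\Big[w,\,\tfrac{1}{\rho}(y-w)\Big], \] with initialization $x(0),z(0)\in\mathcal{K}$ and $y(0),w(0)\in\mathcal{V}$. Then $x(t)\in\mathcal{K}$ and $y(t)\in\mathcal{V}$ for all $t\ge 0$, and $(x(t),y(t))$ converges asymptotically to some saddle point $(x^*,y^* )$ of $L$.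
   Context: For a closed convex set $\mathcal{K}\subset\mathbb{R}^n$ and $y\in\mathbb{R}^n$, $\Psi_{\mathcal{K}}[y]=\arg\min_{z\in\mathcal{K}}\|z-y\|$ is the Euclidean projection. For $x\in\mathcal{K}$ and $v\in\mathbb{R}^n$, the vector field projection is $\Pi_{\mathcal{K}}[x,v]=\lim_{\delta\to0^+}\frac{\Psi_{\mathcal{K}}[x+\delta v]-x}{\delta}$. These dynamics are the projected saddle flow associated with the regularized Lagrangian $\frac{1}{2\rho}\|x-z\|^2+L(x,y)-\frac{1}{2\rho}\|y-w\|^2$ for the problem $\min_{x\in\mathcal{K}}\max_{y\in\mathcal{V}}L(x,y)$. *)

(* Defs.v *)
From HB Require Import structures.
From mathcomp Require Import all_boot all_order all_algebra.
From mathcomp Require Import all_classical all_reals all_analysis.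
Set Implicit Arguments. Unset Strict Implicit. Unset Printing Implicit Defensive.
Import Order.TTheory GRing.Theory Num.Theory.
Import numFieldNormedType.Exports.
Local Open Scope classical_set_scope.
Local Open Scope ring_scope.

Section Defs.
Variable R : realType.

Definition enorm (n : nat) (v : 'rV[R]_n) : R :=
  Num.sqrt (\sum_(i < n) v ord0 i ^+ 2).

(* Euclidean projection Psi_K[y] = argmin_{z in K} ||z - y|| (a default value
   is returned only if no minimiser exists, e.g. K empty) *)
Definition eproj (n : nat) (K : set 'rV[R]_n) (y : 'rV[R]_n) : 'rV[R]_n :=
  xget 0 [set z | K z /\ forall w, K w -> enorm (z - y) <= enorm (w - y)].

Definition vf_proj (n : nat) (K : set 'rV[R]_n) (x v u : 'rV[R]_n) : Prop :=
  (fun d : R => d^-1 *: (eproj K (x + d *: v) - x)) @ 0^'+ --> u.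

Definition abs_cont_on (a b : R) (f : R -> R) : Prop :=
  forall eps : R, 0 < eps -> exists2 del : R, 0 < del &
    forall (k : nat) (s t : 'I_k -> R),
      (forall i, a <= s i /\ s i <= t i /\ t i <= b) ->
      (forall i j, i != j -> t i <= s j \/ t j <= s i) ->
      \sum_(i < k) (t i - s i) < del ->
      \sum_(i < k) `|f (t i) - f (s i)| < eps.

Definition loc_abs_cont (n : nat) (x : R -> 'rV[R]_n) : Prop :=
  forall T : R, 0 < T -> forall i : 'I_n, abs_cont_on 0 T (fun t => x t ord0 i).

Definition convex_fun (n : nat) (f : 'rV[R]_n -> R) : Prop :=
  forall (x x' : 'rV[R]_n) (l : R), 0 <= l -> l <= 1 ->
    f (l *: x + (1 - l) *: x') <= l * f x + (1 - l) * f x'.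
Definition concave_fun (n : nat) (f : 'rV[R]_n -> R) : Prop :=
  convex_fun (fun x => - f x).

Definition C1 (n m : nat) (L : 'rV[R]_n -> 'rV[R]_m -> R) : Prop :=
  (forall p : 'rV[R]_n * 'rV[R]_m, differentiable (fun q => L q.1 q.2) p) /\
  (forall v : 'rV[R]_n * 'rV[R]_m, continuous (fun p => 'd (fun q => L q.1 q.2) p v)).

Definition gradx (n m : nat) (L : 'rV[R]_n -> 'rV[R]_m -> R) x y : 'rV[R]_n :=
  \row_i derive (fun x' => L x' y) x (delta_mx ord0 i).
Definition grady (n m : nat) (L : 'rV[R]_n -> 'rV[R]_m -> R) x y : 'rV[R]_m :=
  \row_j derive (fun y' => L x y') y (delta_mx ord0 j).

Definition saddle_point (n m : nat) (K : set 'rV[R]_n) (V : set 'rV[R]_m)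
  (L : 'rV[R]_n -> 'rV[R]_m -> R) xs ys : Prop :=
  K xs /\ V ys /\ forall x y, K x -> V y -> L xs y <= L xs ys /\ L xs ys <= L x ys.

(* Caratheodory solution on [0,+oo) of the projected regularized saddle flow *)
Definition rsf_solution (n m : nat) (K : set 'rV[R]_n) (V : set 'rV[R]_m)
  (L : 'rV[R]_n -> 'rV[R]_m -> R) (rho : R)
  (x z : R -> 'rV[R]_n) (y w : R -> 'rV[R]_m) : Prop :=
  loc_abs_cont x /\ loc_abs_cont z /\ loc_abs_cont y /\ loc_abs_cont w /\
  {ae lebesgue_measure, forall t : R, 0 < t ->
     [/\ derivable x t 1, derivable z t 1, derivable y t 1 & derivable w t 1] /\
     [/\ vf_proj K (x t) (- gradx L (x t) (y t) - rho^-1 *: (x t - z t)) (derive1 x t),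
         vf_proj K (z t) (rho^-1 *: (x t - z t)) (derive1 z t),
         vf_proj V (y t) (grady L (x t) (y t) - rho^-1 *: (y t - w t)) (derive1 y t) &
         vf_proj V (w t) (rho^-1 *: (y t - w t)) (derive1 w t)]}.

End Defs.

(* Main.v *)
Require Import Defs.
From HB Require Import structures.
From mathcomp Require Import all_boot all_order all_algebra.
From mathcomp Require Import all_classical all_reals all_analysis.
From mathcomp Require Import measurable_realfun ring lra.
Set Implicit Arguments.
Unset Strict Implicit.
Unset Printing Implicit Defensive.
Import Order.TTheory GRing.Theory Num.Theory.
Import numFieldNormedType.Exports.
Local Open Scope classical_set_scope.
Local Open Scope ring_scope.

(** The projected velocity u = Pi_K[x, v] satisfies <u - v, c - x> >= 0 for all c in K, so together
    with convexity the flow is governed by variational inequalities. For a saddle point (xs, ys) the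
    energy |x - xs|^2 + |z - xs|^2 + |y - ys|^2 + |w - ys|^2 decreases at rate at least
    (2/rho)(|x - z|^2 + |y - w|^2); this gap grows at most linearly, hence tends to 0, and
    then the increments of x and y over unit time intervals tend to 0 as well. A cluster point of
    (x, y) is a saddle point, since a profitable deviation c would make |x - c|^2 drop by a fixed
    amount over a unit time interval. The energy relative to that saddle point is nonincreasing and
    small along a sequence, so it tends to 0. *)

(** Solutions are only absolutely continuous: velocities exist at almost every time, and the
    projected field may jump at the boundary of the sets. Hence each estimate bounds the increment
    of a squared distance over a time interval, obtained through [abs_cont_increment_le] from a
    bound on its derivative at almost every time. Saddle points need not be unique, so the energy
    relative to the given one yields only boundedness and the vanishing gap; the limit has to be
    found by compactness and then taken as a new reference point. The gradient part of the velocity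
    of x need not tend to 0, so x is controlled through z, whose velocity is driven by x - z alone.
    Excluding a profitable deviation c rests on <x', x - c> <= L(c, y) - L(x, y) - <x - z, x -
    c>/rho, whose last term tends to 0: a gain that persists over a time window is incompatible with
    an x that is nearly at rest. *)

(** * An increment bound for absolutely continuous functions *)

(** The supremum of the points of [a, b] satisfying [P] is reached and cannot lie below [b]. Letting
    [s] and [u] straddle [t] covers both the passage to a limit from the left and the advance to the
    right. *)
Lemma real_induction (R : realType) (a b : R) (P : R -> Prop) :
  a <= b -> P a ->
  (forall t, a <= t <= b -> exists2 r : R, 0 < r &
     forall s u, a <= s -> t - r < s -> s <= t -> t <= u -> u < t + r ->
       u <= b -> P s -> P u) ->
  P b.
Proof.
move=> ab Pa step.
pose S : set R := [set t | a <= t <= b /\ P t].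
have Sa : S a by split=> //; rewrite lexx.
have Sub : has_ubound S by exists b => t [/andP[_ tb] _].
have hS : has_sup S by split=> //; exists a.
have aT : a <= sup S by exact: sup_upper_bound.
have Tb : sup S <= b by apply: ge_sup; [exists a | move=> t [/andP[_ tb] _]].
have [|r r0 hr] := step (sup S); first by rewrite aT Tb.
have [s [/andP[sa sb] Ps] rs] := sup_adherent r0 hS.
have sT : s <= sup S by apply: sup_upper_bound => //; split=> //; rewrite sa sb.
have [bT|Tb'] := leP b (sup S).
  have <- : sup S = b by apply/eqP; rewrite eq_le bT Tb.
  by apply: (hr s) => //; rewrite ltrDl.
pose u := Num.min b (sup S + r / 2).
have Tu : sup S < u by rewrite /u lt_min Tb' ltrDl divr_gt0.
have Su : S u.
  split.
    by rewrite (le_trans aT (ltW Tu)) /u ge_min lexx.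
  apply: (hr s) => //; first exact: ltW.
    by rewrite /u gt_min; apply/orP; right; lra.
  by rewrite /u ge_min lexx.
have : u <= sup S by exact: sup_upper_bound.
by rewrite leNgt Tu.
Qed.

(** Differentiability at the single point [t] controls every short chord straddling [t]: each half
    is compared with the value at [t] and the two are added. This is the form in which
    [real_induction] steps over [t]; the room between [d] and [c] absorbs the remainder. *)
Lemma derive_slope_le (R : realType) (f : R -> R) (t d c : R) :
  is_derive t 1 f d -> d < c ->
  exists2 r : R, 0 < r & forall s u, t - r < s -> s <= t -> t <= u ->
    u < t + r -> f u - f s <= c * (u - s).
Proof.
move=> [fd fE] dc.
have cvd : h^-1 *: ((f \o shift t) (h *: 1) - f t) @[h --> 0^'] --> d.
  by rewrite -fE; exact: fd.
have /cvgrPdist_lt /(_ (c - d)) := cvd; rewrite subr_gt0 => /(_ dc) H.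
have : \forall h \near 0^', `|d - h^-1 *: ((f \o shift t) (h *: 1) - f t)| < c - d by [].
rewrite near_withinE => /nbhs_ballP[r /= r0 hr].
have key (h : R) : `|h| < r -> h != 0 -> h^-1 * (f (h + t) - f t) < c.
  move=> hlt h0; have := hr h; rewrite /ball /= sub0r normrN => /(_ hlt h0).
  rewrite /shift /= /GRing.scale /= mulr1 => H1.
  by have := ler_norm (- (d - h^-1 * (f (h + t) - f t))); rewrite normrN; lra.
have up u : t <= u -> u < t + r -> f u - f t <= c * (u - t).
  move=> tu ur; have [->|ut] := eqVneq u t; first by rewrite !subrr mulr0.
  have ut' : 0 < u - t by rewrite subr_gt0 lt_neqAle eq_sym ut.
  have /key : `|u - t| < r by rewrite gtr0_norm //; lra.
  rewrite subrK (gt_eqF ut') => /(_ isT).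
  by rewrite mulrC ltr_pdivrMr // => /ltW.
have dn s : t - r < s -> s <= t -> f t - f s <= c * (t - s).
  move=> rs st; have [->|ut] := eqVneq s t; first by rewrite !subrr mulr0.
  have ut' : 0 < t - s by rewrite subr_gt0 lt_neqAle ut.
  have /key : `|s - t| < r by rewrite ltr0_norm //; lra.
  rewrite subrK; have -> : (s - t != 0) by rewrite lt_eqF //; lra.
  move=> /(_ isT); rewrite -(opprB t s) invrN mulNr -mulrN opprB.
  by rewrite mulrC ltr_pdivrMr // => /ltW.
exists r => // s u rs st tu ur.
by have := up _ tu ur; have := dn _ rs st; lra.
Qed.

Lemma negligible_open_cover (R : realType) (N : set R) (e : R) :
  lebesgue_measure.-negligible N -> 0 < e ->
  exists U : set R, [/\ open U, N `<=` U & (lebesgue_measure U < e%:E)%E].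
Proof.
move=> [A [mA mA0 NA]] e0.
have A0 : lebesgue_measure A = 0%E := mA0.
have [|U [oU AU mU]] := @lebesgue_regularity_outer R A e mA _ e0.
  by rewrite [X in (X < _)%E]A0 ltry.
exists U; split=> //; first exact: subset_trans AU.
have mUm : measurable U by exact: open_measurable.
have -> : U = A `|` (U `\` A) by rewrite setDUK.
apply: le_lt_trans (measureU2 _ _ _) _ => //; first exact: measurableD.
by rewrite [X in (X + _)%E]A0 add0e.
Qed.

(** Charges the length of an interval inside [U] to the measure of [U], so that the total length of
    all crossings stays below that measure. *)
Lemma open_ereal_length_add (R : realType) (U : set R) (a s u : R) :
  open U -> a <= s -> s <= u -> `]s, u] `<=` U ->
  (lebesgue_measure (U `&` `]a, s]) + (u - s)%:E <=
   lebesgue_measure (U `&` `]a, u]))%E.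
Proof.
move=> oU as_ su sU.
have mU : measurable U by exact: open_measurable.
have -> : (u - s)%:E = lebesgue_measure `]s, u].
  rewrite lebesgue_measure_itv /= lte_fin; case: ltP => // us.
  have -> : s = u by apply/eqP; rewrite eq_le su us.
  by rewrite subrr.
rewrite -measureU //; last 2 first.
- exact: measurableI.
- apply/seteqP; split=> // v /=; rewrite !in_itv /= => -[[_ /andP[_ vs]] /andP[sv _]].
  by have := lt_le_trans sv vs; rewrite ltxx.
apply: le_measure; rewrite ?inE.
- by apply: measurableU => //; exact: measurableI.
- exact: measurableI.
- move=> v /=; rewrite !in_itv /= => -[[Uv /andP[av vs]]|/andP[sv vu]].
    by split=> //; rewrite av (le_trans vs).
  split; first by apply: sU; rewrite /= in_itv /= sv.
  by rewrite (le_lt_trans as_ sv).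
Qed.

(* Where f is differentiable the slope bound propagates directly. The exceptional points lie in
   an open set U of small measure; crossing U costs at most the variation of f over finitely many
   disjoint intervals of small total length, which absolute continuity controls. *)
Lemma abs_cont_increment_le (R : realType) (a b c : R) (f : R -> R) :
  a <= b -> abs_cont_on a b f ->
  {ae lebesgue_measure, forall t : R, a < t < b ->
     exists2 d : R, is_derive t 1 f d & d <= c} ->
  f b - f a <= c * (b - a).
Proof.
move=> ab fac fae; apply/ler_addgt0Pr => e e0.
have [ba|ba] := eqVneq a b; first by rewrite -ba !subrr mulr0 add0r ltW.
have ba0 : 0 < b - a by rewrite subr_gt0 lt_neqAle ba.
(* The error [e] is shared equally by the excess slope [e1], the variation of [f] over the crossings
   of [U], and [|c|] times their total length. The [+ 1] below keeps a divisor positive when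
   [c = 0]. *)
pose e1 := e / 3 / (b - a).
have e10 : 0 < e1 by rewrite !divr_gt0.
have c1 : 0 < `|c| + 1 by rewrite ltr_wpDl.
have [|del0 del00 hdel] := fac (e / 3); first by rewrite divr_gt0.
pose del := Num.min del0 (e / 3 / (`|c| + 1)).
have del_gt0 : 0 < del by rewrite lt_min del00 !divr_gt0.
pose N := ~` [set t : R | a < t < b -> exists2 d : R, is_derive t 1 f d & d <= c].
have Nneg : lebesgue_measure.-negligible N by exact: fae.
(* The derivative is given only on the open interval, so both ends join the exceptional set. *)
have N' : lebesgue_measure.-negligible (N `|` [set a; b]).
  have n1 v : lebesgue_measure.-negligible [set v : R].
    by apply/negligibleP => //; exact: lebesgue_measure_set1.
  by apply: negligibleU => //; apply: negligibleU; exact: n1.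
have [U [oU NU mU]] := negligible_open_cover N' del_gt0.
have mUm : measurable U by exact: open_measurable.
(* The line of slope [c + e1] is corrected by the crossings of [U] made so far, whose lengths are
   charged to the part of [U] already passed. *)
pose P t := exists (k : nat) (s u : nat -> R),
  [/\ forall i, (i < k)%N -> a <= s i /\ s i <= u i /\ u i <= t,
      forall i j, (i < j < k)%N -> u i <= s j,
      ((\sum_(i < k) (u i - s i))%:E <= lebesgue_measure (U `&` `]a, t]))%E &
      f t - f a <= (c + e1) * (t - a) + \sum_(i < k) `|f (u i) - f (s i)| +
     `|c| * \sum_(i < k) (u i - s i)].
have Pb : P b.
  apply: (real_induction ab).
    exists 0%N, (fun _ => 0), (fun _ => 0); split=> //.
      by rewrite big_ord0 measure_ge0.
    by rewrite !big_ord0 !subrr !mulr0 !addr0.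
  move=> t /andP[at_ tb]; have [Ut|nUt] := pselect (U t).
    have /nbhs_ballP[r /= r0 hr] : nbhs t U by exact: open_nbhs_nbhs.
    exists r => // s u as_ rs st tu ur ub [k [p [q [hpq hqp hm hf]]]].
    have su := le_trans st tu.
    pose p' i := if i == k then s else p i.
    pose q' i := if i == k then u else q i.
    have pE i : (i < k)%N -> p' i = p i /\ q' i = q i.
      by move=> ik; rewrite /p' /q' ltn_eqF.
    have pk : p' k = s /\ q' k = u by rewrite /p' /q' eqxx.
    exists k.+1, p', q'; split.
    - move=> i; rewrite ltnS leq_eqVlt => /orP[/eqP->|ik].
        by rewrite !pk.1 !pk.2.
      have [-> ->] := pE _ ik; have [? [? qs]] := hpq _ ik.
      by rewrite (le_trans qs).
    - move=> i j /andP[ij]; rewrite ltnS leq_eqVlt => /orP[/eqP jk|jk].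
        by subst j; rewrite pk.1 (pE _ ij).2; have [_ []] := hpq _ ij.
      by rewrite (pE _ jk).1 (pE _ (ltn_trans ij jk)).2 hqp // ij.
    - rewrite big_ord_recr /= pk.1 pk.2 EFinD.
      apply: le_trans (open_ereal_length_add oU as_ su _).
        rewrite leeD2r // (eq_bigr (fun i : 'I_k => q i - p i)) // => i _.
        by have [-> ->] := pE _ (ltn_ord i).
      move=> v /=; rewrite in_itv /= => /andP[sv vu]; apply: hr.
      rewrite /ball /= ltr_distl; lra.
    - rewrite !big_ord_recr /= pk.1 pk.2.
      rewrite (eq_bigr (fun i : 'I_k => `|f (q i) - f (p i)|)); last first.
        by move=> i _; have [-> ->] := pE _ (ltn_ord i).
      rewrite [X in `|c| * (X + _)](eq_bigr (fun i : 'I_k => q i - p i)); last first.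
        by move=> i _; have [-> ->] := pE _ (ltn_ord i).
      have h1 := ler_norm (f u - f s).
      (* Over a crossing the term [c * (u - s)] may be negative; the summand [|c| * (u - s)] of the
         invariant compensates for it. *)
      have h2 : 0 <= (`|c| + c) * (u - s).
        by rewrite mulr_ge0 ?subr_ge0 //; have := ler_norm (- c); rewrite normrN; lra.
      have h3 : 0 <= e1 * (u - s) by rewrite mulr_ge0 ?subr_ge0 // ltW.
      by lra.
  have nN : ~ N t by move=> Nt; apply: nUt; apply: NU; left.
  have ta : t <> a by move=> ta'; apply: nUt; apply: NU; right; left.
  have tb' : t <> b by move=> tb''; apply: nUt; apply: NU; right; right.
  have [d fd dc] : exists2 d : R, is_derive t 1 f d & d <= c.
    apply: contrapT => nd; apply: nN; rewrite /N /= => H; apply: nd; apply: H.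
    by rewrite !lt_neqAle at_ tb !andbT eq_sym; apply/andP; split; apply/eqP.
  have [|r r0 hr] := derive_slope_le fd (c := c + e1); first by lra.
  exists r => // s u as_ rs st tu ur ub [k [p [q [hpq hqp hm hf]]]].
  exists k, p, q; split => //.
  - by move=> i /hpq[? [? qs]]; do 2!split=> //; apply: le_trans qs _; lra.
  - apply: (le_trans hm); apply: le_measure; rewrite ?inE; try exact: measurableI.
    apply: setIS => v /=; rewrite !in_itv /= => /andP[-> vs] /=; lra.
  - by have := hr _ _ rs st tu ur; lra.
have [k [p [q [hpq hqp hm hf]]]] := Pb.
have hl : \sum_(i < k) (q i - p i) < del.
  rewrite -lte_fin; apply: le_lt_trans mU; apply: (le_trans hm).
  by apply: le_measure; rewrite ?inE //; exact: measurableI.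
have H : \sum_(i < k) `|f (q i) - f (p i)| < e / 3.
  apply: (hdel k (fun i => p i) (fun i => q i)).
  - by move=> i; exact: hpq.
  - move=> i j; rewrite -val_eqE /= neq_ltn => /orP[ij|ji]; [left|right].
      by apply: hqp; rewrite ij /=.
    by apply: hqp; rewrite ji /=.
  - by apply: lt_le_trans hl _; rewrite ge_min lexx.
have H2 : `|c| * \sum_(i < k) (q i - p i) <= e / 3.
  have dle : del <= e / 3 / (`|c| + 1) by rewrite ge_min lexx orbT.
  apply: (@le_trans _ _ (`|c| * (e / 3 / (`|c| + 1)))).
    by rewrite ler_wpM2l // (le_trans (ltW hl)).
  rewrite mulrA ler_pdivrMr // mulrC ler_wpM2l ?divr_ge0 ?ltW //; lra.
have : e1 * (b - a) = e / 3 by rewrite /e1 divfK // gt_eqF.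
by lra.
Qed.

(** * Closure properties of absolute continuity *)

Lemma abs_cont_on_sub (R : realType) (a b a' b' : R) (f : R -> R) :
  a <= a' -> b' <= b -> abs_cont_on a b f -> abs_cont_on a' b' f.
Proof.
move=> aa bb fac e /fac[d d0 hd]; exists d => // k s t st dis.
by apply: hd => // i; have [? []] := st i; lra.
Qed.

Lemma abs_cont_on_unif (R : realType) (a b : R) (f : R -> R) :
  abs_cont_on a b f -> forall e, 0 < e -> exists2 d : R, 0 < d &
    forall s t, a <= s <= b -> a <= t <= b -> `|t - s| < d -> `|f t - f s| < e.
Proof.
move=> fac e /fac[d d0 hd]; exists d => //.
have H s t : a <= s -> s <= t -> t <= b -> t - s < d -> `|f t - f s| < e.
  move=> as_ st tb std; have := hd 1%N (fun=> s) (fun=> t).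
  rewrite !big_ord1; apply=> //; first by move=> i j; rewrite !ord1 eqxx.
move=> s t /andP[as_ sb] /andP[at_ tb]; have [st|ts] := leP s t.
  by rewrite ger0_norm ?subr_ge0 //; exact: H.
by rewrite distrC ger0_norm ?subr_ge0 ?ltW // distrC => ?; apply: H => //; rewrite ltW.
Qed.

(** Uniform continuity provides one radius valid at every point, so real induction extends the bound
    past [t] at the price of [|f t| + 1]. *)
Lemma abs_cont_on_bounded (R : realType) (a b : R) (f : R -> R) :
  a <= b -> abs_cont_on a b f ->
  exists2 M : R, 0 <= M & forall t, a <= t <= b -> `|f t| <= M.
Proof.
move=> ab fac; have [d d0 hd] := abs_cont_on_unif fac ltr01.
apply: (real_induction (P := fun u => exists2 M : R, 0 <= M &
  forall t, a <= t <= u -> `|f t| <= M) ab).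
  by exists `|f a| => // t; rewrite -eq_le => /eqP <-.
move=> t /andP[at_ tb]; exists d => // s u as_ ts st tu ud ub [M M0 hM].
exists (Num.max M (`|f t| + 1)); first by rewrite le_max M0.
move=> v /andP[av vu]; rewrite le_max; have [vs|sv] := leP v s.
  by rewrite hM ?av.
apply/orP; right; have /hd : a <= t <= b by rewrite at_.
move=> /(_ v); rewrite av (le_trans vu ub) => /(_ isT); rewrite ltr_distl => H.
have /H/ltW : t - d < v < t + d by lra.
have := ler_normB (f v - f t) (- f t); rewrite opprK subrK normrN; lra.
Qed.

Lemma abs_cont_on_cst (R : realType) (a b c : R) : abs_cont_on a b (fun=> c).
Proof.
move=> e e0; exists 1 => // k s t _ _ _.
by rewrite big1 // => i _; rewrite subrr normr0.
Qed.

Lemma abs_cont_onD (R : realType) (a b : R) (f g : R -> R) :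
  abs_cont_on a b f -> abs_cont_on a b g -> abs_cont_on a b (fun t => f t + g t).
Proof.
move=> fac gac e e0; have e2 : 0 < e / 2 by rewrite divr_gt0.
have [d d0 hd] := fac _ e2; have [d' d0' hd'] := gac _ e2.
exists (Num.min d d'); first by rewrite lt_min d0.
move=> k s t st dis; rewrite lt_min => /andP[h h'].
have H := hd k s t st dis h; have H' := hd' k s t st dis h'.
apply: (@le_lt_trans _ _ (\sum_(i < k) (`|f (t i) - f (s i)| + `|g (t i) - g (s i)|))).
  by apply: ler_sum => i _; rewrite opprD addrACA ler_normD.
by rewrite big_split /=; lra.
Qed.

Lemma abs_cont_onN (R : realType) (a b : R) (f : R -> R) :
  abs_cont_on a b f -> abs_cont_on a b (fun t => - f t).
Proof.
move=> fac e /fac[d d0 hd]; exists d => // k s t st dis h.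
by under eq_bigr do rewrite -opprD normrN; exact: hd.
Qed.

Lemma abs_cont_on_sqr (R : realType) (a b : R) (f : R -> R) :
  a <= b -> abs_cont_on a b f -> abs_cont_on a b (fun t => f t * f t).
Proof.
move=> ab fac e e0; have [M M0 hM] := abs_cont_on_bounded ab fac.
have M1 : 0 < M + M + 1 by lra.
have [|d d0 hd] := fac (e / (M + M + 1)); first by rewrite divr_gt0.
exists d => // k s t st dis h; have := hd k s t st dis h.
rewrite ltr_pdivlMr // => H; apply: le_lt_trans H.
rewrite mulr_suml; apply: ler_sum => i _.
have -> : f (t i) * f (t i) - f (s i) * f (s i) =
  (f (t i) - f (s i)) * (f (t i) + f (s i)) by ring.
rewrite normrM ler_wpM2l //; apply: le_trans (ler_normD _ _) _.
have [? [? ?]] := st i.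
have := hM (s i); have := hM (t i).
by move=> /(_ ltac:(lra)) ? /(_ ltac:(lra)) ?; lra.
Qed.

Lemma abs_cont_on_sum (R : realType) (a b : R) (n : nat) (f : 'I_n -> R -> R) :
  (forall i, abs_cont_on a b (f i)) ->
  abs_cont_on a b (fun t => \sum_(i < n) f i t).
Proof.
elim: n f => [|n IH] f fac.
  by rewrite (_ : (fun _ => _) = fun=> 0) //; [exact: abs_cont_on_cst|apply/funext => t; rewrite big_ord0].
rewrite (_ : (fun _ => _) = fun t => \sum_(i < n) f (widen_ord (leqnSn n) i) t + f ord_max t).
  by apply: abs_cont_onD => //; exact: IH.
by apply/funext => t; rewrite big_ord_recr.
Qed.

(** * The Euclidean inner product and curves in coordinates *)

(** The norm carried by ['rV[R]_n] is the maximum norm. Euclidean geometry is therefore expressed by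
    [dot], and distances appear squared; [norm_lt_dot] returns to the topology. *)
Definition dot (R : realType) (n : nat) (u v : 'rV[R]_n) : R :=
  \sum_(i < n) u ord0 i * v ord0 i.

Lemma dotC (R : realType) (n : nat) (u v : 'rV[R]_n) : dot u v = dot v u.
Proof. by apply: eq_bigr => i _; rewrite mulrC. Qed.

Lemma dotDl (R : realType) (n : nat) (u v w : 'rV[R]_n) :
  dot (u + v) w = dot u w + dot v w.
Proof. by rewrite -big_split; apply: eq_bigr => i _; rewrite mxE mulrDl. Qed.

Lemma dotZl (R : realType) (n : nat) (k : R) (u v : 'rV[R]_n) :
  dot (k *: u) v = k * dot u v.
Proof. by rewrite /dot mulr_sumr; apply: eq_bigr => i _; rewrite mxE mulrA. Qed.

Lemma dotNl (R : realType) (n : nat) (u v : 'rV[R]_n) : dot (- u) v = - dot u v.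
Proof. by rewrite -scaleN1r dotZl mulN1r. Qed.

Lemma dotDr (R : realType) (n : nat) (u v w : 'rV[R]_n) :
  dot w (u + v) = dot w u + dot w v.
Proof. by rewrite ![dot w _]dotC dotDl. Qed.

Lemma dotZr (R : realType) (n : nat) (k : R) (u v : 'rV[R]_n) :
  dot v (k *: u) = k * dot v u.
Proof. by rewrite ![dot v _]dotC dotZl. Qed.

Lemma dotNr (R : realType) (n : nat) (u v : 'rV[R]_n) : dot v (- u) = - dot v u.
Proof. by rewrite ![dot v _]dotC dotNl. Qed.

Definition dotE := (dotDl, dotDr, dotNl, dotNr, dotZl, dotZr).

Lemma dot_sqrD (R : realType) (n : nat) (u v : 'rV[R]_n) :
  dot (u + v) (u + v) = dot u u + 2 * dot u v + dot v v.
Proof. by rewrite !dotE (dotC v u); ring. Qed.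

Lemma dot_ge0 (R : realType) (n : nat) (u : 'rV[R]_n) : 0 <= dot u u.
Proof. by apply: sumr_ge0 => i _; rewrite -expr2 sqr_ge0. Qed.

(* Young's inequality, the only form of Cauchy-Schwarz needed. *)
Lemma dot_young (R : realType) (n : nat) (u v : 'rV[R]_n) (k : R) : 0 < k ->
  dot u v <= k / 2 * dot u u + (2 * k)^-1 * dot v v.
Proof.
move=> k0; have := dot_ge0 (k *: u - v); rewrite !dotE (dotC v u) => H.
have -> : (2 * k)^-1 = k^-1 / 2 by rewrite invfM mulrC.
have H' : 0 <= k * k * dot u u - 2 * k * dot u v + dot v v by lra.
have kV : 0 <= k^-1 by rewrite invr_ge0 ltW.
have := mulr_ge0 kV H'.
have -> : k^-1 * (k * k * dot u u - 2 * k * dot u v + dot v v) =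
  k * dot u u - 2 * dot u v + k^-1 * dot v v by field; rewrite gt_eqF.
lra.
Qed.

Lemma loc_abs_cont_cst (R : realType) (n : nat) (c : 'rV[R]_n) :
  loc_abs_cont (fun=> c).
Proof. by move=> T T0 i; exact: abs_cont_on_cst. Qed.

Lemma loc_abs_contB (R : realType) (n : nat) (x z : R -> 'rV[R]_n) :
  loc_abs_cont x -> loc_abs_cont z -> loc_abs_cont (fun t => x t - z t).
Proof.
move=> xac zac T T0 i; have := abs_cont_onD (xac T T0 i) (abs_cont_onN (zac T T0 i)).
by congr (abs_cont_on _ _ _); apply/funext => t; rewrite !mxE.
Qed.

Lemma abs_cont_on_sqnorm (R : realType) (n : nat) (x : R -> 'rV[R]_n) (a b : R) :
  0 <= a -> a <= b -> loc_abs_cont x -> abs_cont_on a b (fun t => dot (x t) (x t)).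
Proof.
move=> a0 ab xac; apply: abs_cont_on_sum => i; apply: abs_cont_on_sqr => //.
apply: (@abs_cont_on_sub R 0 (b + 1)) => //; first by lra.
by apply: xac; lra.
Qed.

Lemma derive1_coord (R : realType) (n : nat) (x : R -> 'rV[R]_n) (t : R) (i : 'I_n) :
  derivable x t 1 -> is_derive t 1 (fun s => x s ord0 i) (derive1 x t ord0 i).
Proof.
move=> dx; split; first by have /derivable_mxP := dx; exact.
by rewrite derive1E derive_mx // mxE.
Qed.

(** * Euclidean projection and the variational inequality for projected velocities *)

Lemma convex_setE (R : realType) (n : nat) (K : set 'rV[R]_n) (x y : 'rV[R]_n) (l : R) :
  convex_set K -> K x -> K y -> 0 <= l -> l <= 1 -> K (l *: x + (1 - l) *: y).
Proof.
move=> cK Kx Ky l0 l1; have := cK x y (Itv01 l0 l1); rewrite !inE.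
by apply.
Qed.

Lemma enormE (R : realType) (n : nat) (u : 'rV[R]_n) : enorm u = Num.sqrt (dot u u).
Proof. by congr Num.sqrt; apply: eq_bigr => i _; rewrite expr2. Qed.

Lemma le_enorm (R : realType) (n : nat) (u v : 'rV[R]_n) :
  (enorm u <= enorm v) = (dot u u <= dot v v).
Proof. by rewrite !enormE ler_sqrt // dot_ge0. Qed.

Lemma norm_le_enorm (R : realType) (n : nat) (u : 'rV[R]_n) : `|u| <= enorm u.
Proof.
rewrite [leLHS]/Num.Def.normr /= mx_normrE; apply: bigmax_le => [|[i j] _] /=.
  by rewrite sqrtr_ge0.
rewrite (ord1 i) -sqrtr_sqr ler_sqrt ?sumr_ge0 // => [|k _]; last exact: sqr_ge0.
by rewrite (bigD1 j) //= lerDl sumr_ge0 // => k _; exact: sqr_ge0.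
Qed.

Lemma norm_lt_dot (R : realType) (n : nat) (u : 'rV[R]_n) (e : R) :
  0 < e -> dot u u < e ^+ 2 -> `|u| < e.
Proof.
move=> e0 ue; apply: le_lt_trans (norm_le_enorm u) _.
by rewrite enormE -[X in _ < X](gtr0_norm e0) -sqrtr_sqr ltr_sqrt // exprn_gt0.
Qed.

Lemma cvg_dot (R : realType) (n : nat) (T : Type) (F : set_system T) {FF : Filter F}
    (f g : T -> 'rV[R]_n) (u v : 'rV[R]_n) :
  f t @[t --> F] --> u -> g t @[t --> F] --> v -> dot (f t) (g t) @[t --> F] --> dot u v.
Proof.
move=> fu gv; apply: cvg_big => [|i _]; first exact: add_continuous.
have cc (w : 'rV[R]_n) : {for w, continuous (fun M : 'rV[R]_n => M ord0 i)}.
  exact: coord_continuous.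
by apply: cvgM; [exact: continuous_cvg (cc u) fu | exact: continuous_cvg (cc v) gv].
Qed.

Lemma continuous_sqdist (R : realType) (n : nat) (y : 'rV[R]_n) :
  continuous (fun w : 'rV[R]_n => dot (w - y) (w - y)).
Proof.
move=> w; have h : (fun v : 'rV[R]_n => v - y) @ nbhs w --> w - y.
  by apply: (@cvgB R 'rV[R]_n _ (nbhs w) _ id (fun=> y)); [exact: cvg_id|exact: cvg_cst].
exact: (cvg_dot h h).
Qed.

Lemma closed_sqdist_le (R : realType) (n : nat) (y : 'rV[R]_n) (r : R) :
  closed [set w : 'rV[R]_n | dot (w - y) (w - y) <= r].
Proof.
pose f (w : 'rV[R]_n) := dot (w - y) (w - y).
have cf : continuous f := @continuous_sqdist R n y.
by have := (continuous_closedP f).1 cf [set s | s <= r]; apply; exact: closed_le.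
Qed.

Lemma bounded_sqdist_le (R : realType) (n : nat) (y : 'rV[R]_n) (r : R) :
  bounded_set [set w : 'rV[R]_n | dot (w - y) (w - y) <= r].
Proof.
exists (Num.sqrt r + `|y|); split; first exact: num_real.
move=> M rM w /= wr; apply: le_trans (ltW rM).
have -> : w = (w - y) + y by rewrite subrK.
apply: le_trans (ler_normD _ _) _; rewrite lerD2r.
apply: le_trans (norm_le_enorm _) _; rewrite enormE ler_wsqrtr //.
Qed.

(** Cutting [K] with the closed ball around [y] through a point [c] of [K] gives a compact set, and
    points outside that ball are no closer to [y] than [c]. A minimiser thus exists and the default
    value of [eproj] is never taken. *)
Lemma eprojP (R : realType) (n : nat) (K : set 'rV[R]_n) (y : 'rV[R]_n) :
  closed K -> K !=set0 ->
  K (eproj K y) /\ forall w, K w -> enorm (eproj K y - y) <= enorm (w - y).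
Proof.
move=> cK [c Kc]; rewrite /eproj; case: xgetP => [p _ [] //|nomin]; exfalso.
pose B := [set w : 'rV[R]_n | dot (w - y) (w - y) <= dot (c - y) (c - y)].
have [||| p] := @EVT_min_rV R n (fun w => dot (w - y) (w - y)) (K `&` B).
- by exists c; split => //; rewrite /B /=.
- apply: bounded_closed_compact.
    have [M [rM HM]] := bounded_sqdist_le y (dot (c - y) (c - y)).
    by exists M; split=> // N MN w [_ Bw]; exact: HM.
  by apply: closedI => //; exact: closed_sqdist_le.
- exact/continuous_subspaceT/continuous_sqdist.
rewrite inE => -[Kp Bp] pmin; apply: (nomin p); split=> // w Kw; rewrite le_enorm.
have [wB|/ltW cw] := leP (dot (w - y) (w - y)) (dot (c - y) (c - y)).
  by apply: pmin; rewrite inE.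
exact: le_trans cw.
Qed.

Lemma eproj_variational (R : realType) (n : nat) (K : set 'rV[R]_n) (y c : 'rV[R]_n) :
  closed K -> convex_set K -> K c -> 0 <= dot (eproj K y - y) (c - eproj K y).
Proof.
move=> cK vK Kc; have [Kp pmin] := eprojP y cK (ex_intro _ c Kc).
set p := eproj K y in Kp pmin *; rewrite leNgt; apply/negP => neg.
have D0 := dot_ge0 (c - p); set D := dot (c - p) (c - p) in D0.
set a := dot (p - y) (c - p) in neg *.
(* Moving from [p] towards [c] by [l] changes the squared distance to [y] by [l * (l * D + 2 * a)].
   This [l] gives [l * D <= - a], hence a strict decrease; [D + 1] avoids division by 0. *)
pose l := Num.min 1 (- a / (D + 1)).
have l0 : 0 < l by rewrite lt_min ltr01 divr_gt0 //; lra.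
have l1 : l <= 1 by rewrite ge_min lexx.
have lD : l * (D + 1) <= - a by rewrite -ler_pdivlMr ?ltr_wpDl // ge_min lexx orbT.
have := pmin _ (convex_setE vK Kc Kp (ltW l0) l1); rewrite le_enorm.
have -> : l *: c + (1 - l) *: p - y = (p - y) + l *: (c - p).
  by apply/rowP => i; rewrite !mxE; ring.
clearbody l; rewrite [X in _ <= X]dot_sqrD dotZr dotZl dotZr -/a -/D => H.
have : l * (l * D + 2 * a) < 0 by rewrite pmulr_rlt0 //; lra.
by rewrite ltNge => /negP; apply; lra.
Qed.

(** The variational inequality of the projected point, divided by [d], passes to the limit as [d]
    tends to 0 from the right. Membership of [x] in [K] is a conclusion: a convergent quotient
    forces the projected points to tend to [x], and [K] is closed. This is the source of the
    invariance of the sets. *)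
Lemma vf_proj_variational (R : realType) (n : nat) (K : set 'rV[R]_n) (x v u : 'rV[R]_n) :
  closed K -> convex_set K -> K !=set0 -> vf_proj K x v u ->
  K x /\ forall c, K c -> dot u (x - c) <= dot v (x - c).
Proof.
move=> cK vK K0 uP.
pose p (d : R) := eproj K (x + d *: v).
have Kp d : K (p d) by have [] := eprojP (x + d *: v) cK K0.
have d0 : (d : R) @[d --> 0^'+] --> (0 : R) by apply: cvg_within_filter; exact: cvg_id.
have pE : {near 0^'+, (fun d : R => x + d *: (d^-1 *: (p d - x))) =1 p}.
  near=> d; have dgt : 0 < d by near: d; exact: nbhs_right_gt.
  by rewrite scalerA divff ?gt_eqF // scale1r addrC subrK.
have px : p d @[d --> 0^'+] --> x.
  rewrite -[x in _ --> x](addr0 x) -(scale0r u).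
  apply: (cvg_trans (near_eq_cvg pE)).
  by apply: cvgD; [exact: cvg_cst | apply: cvgZ].
split; first by apply: (closed_cvg K cK) px; exact: nearW.
move=> c Kc.
have H : dot (d^-1 *: (p d - x) - v) (c - p d) @[d --> 0^'+] --> dot (u - v) (c - x).
  apply: cvg_dot; first by apply: cvgB; [exact: uP|exact: cvg_cst].
  by apply: cvgB; [exact: cvg_cst|].
have : 0 <= dot (u - v) (c - x).
  apply: (cvgr_to_ge H); near=> d.
  have dgt : 0 < d by near: d; exact: nbhs_right_gt.
  have -> : d^-1 *: (p d - x) - v = d^-1 *: (p d - (x + d *: v)).
    by rewrite opprD addrA [in RHS]scalerBr scalerA mulVf ?gt_eqF // scale1r.
  rewrite dotZl mulr_ge0 ?invr_ge0 ?(ltW dgt) //; exact: eproj_variational.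
by rewrite -(opprB x c) !dotE; lra.
Unshelve. all: by end_near.
Qed.

(** * Gradient inequalities for convex and concave functions *)

Lemma derive_le_convex (R : realType) (n : nat) (f : 'rV[R]_n -> R) (x c : 'rV[R]_n) :
  convex_fun f -> derivable f x (c - x) -> 'D_(c - x) f x <= f c - f x.
Proof.
move=> vf df.
have H : h^-1 *: (f (h *: (c - x) + x) - f x) @[h --> (0 : R)^'+] --> 'D_(c - x) f x.
  apply: cvg_trans df; apply: cvg_app => A [r r0 hr]; exists r => // h hb h0.
  by apply: hr => //; rewrite gt_eqF.
apply: (cvgr_to_le H); near=> h.
have h0 : 0 < h by near: h; exact: nbhs_right_gt.
have h1 : h <= 1 by apply: ltW; near: h; exact: nbhs_right_lt.
have := vf c x h (ltW h0) h1.
have -> : h *: c + (1 - h) *: x = h *: (c - x) + x.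
  by apply/rowP => i; rewrite !mxE; ring.
move=> H1; rewrite /GRing.scale /= mulrC ler_pdivrMr //; lra.
Unshelve. all: by end_near.
Qed.

Lemma dot_grad (R : realType) (n : nat) (f : 'rV[R]_n -> R) (x v : 'rV[R]_n) :
  differentiable f x ->
  dot (\row_i derive f x (delta_mx ord0 i)) v = 'D_v f x.
Proof.
move=> df; rewrite deriveE // {2}(row_sum_delta v) linear_sum /dot.
by apply: eq_bigr => i _; rewrite mxE deriveE // linearZ mulrC.
Qed.

Lemma grad_le_convex (R : realType) (n : nat) (f : 'rV[R]_n -> R) (x c : 'rV[R]_n) :
  convex_fun f -> differentiable f x ->
  dot (\row_i derive f x (delta_mx ord0 i)) (c - x) <= f c - f x.
Proof.
move=> vf df; rewrite dot_grad //; apply: derive_le_convex => //.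
exact: diff_derivable.
Qed.

Lemma C1_differentiablel (R : realType) (n m : nat) (L : 'rV[R]_n -> 'rV[R]_m -> R) x y :
  C1 L -> differentiable (fun x' => L x' y) x.
Proof.
move=> [dL _].
apply: (@differentiable_comp _ _ _ _ (fun x' => (x', y)) (fun q => L q.1 q.2)) => //.
Qed.

Lemma C1_differentiabler (R : realType) (n m : nat) (L : 'rV[R]_n -> 'rV[R]_m -> R) x y :
  C1 L -> differentiable (fun y' => L x y') y.
Proof.
move=> [dL _].
apply: (@differentiable_comp _ _ _ _ (fun y' => (x, y')) (fun q => L q.1 q.2)) => //.
Qed.

Lemma C1_continuous (R : realType) (n m : nat) (L : 'rV[R]_n -> 'rV[R]_m -> R) :
  C1 L -> continuous (fun q : 'rV[R]_n * 'rV[R]_m => L q.1 q.2).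
Proof. by move=> [dL _] q; exact: differentiable_continuous. Qed.

Lemma gradx_le (R : realType) (n m : nat) (L : 'rV[R]_n -> 'rV[R]_m -> R) x y c :
  C1 L -> convex_fun (fun x0 => L x0 y) ->
  dot (gradx L x y) (c - x) <= L c y - L x y.
Proof. by move=> cL vL; apply: grad_le_convex => //; exact: C1_differentiablel. Qed.

Lemma grady_ge (R : realType) (n m : nat) (L : 'rV[R]_n -> 'rV[R]_m -> R) x y c :
  C1 L -> concave_fun (fun y0 => L x y0) ->
  L x c - L x y <= dot (grady L x y) (c - y).
Proof.
move=> cL vL; have dL := C1_differentiabler x y cL.
have dLv : derivable (fun y' => L x y') y (c - y) by exact: diff_derivable.
have := derive_le_convex vL (derivableN dLv).
by rewrite deriveN // dot_grad //; lra.
Qed.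

(** * From almost every time to every time *)

Lemma ae_dense (R : realType) (P : R -> Prop) (a b : R) :
  {ae lebesgue_measure, forall t : R, P t} -> a < b ->
  exists2 t : R, a < t < b & P t.
Proof.
move=> aeP ab; apply: contrapT => nP.
have nN : lebesgue_measure.-negligible (`]a, b[%classic : set R).
  apply: negligibleS aeP => t /=; rewrite in_itv /= => tab Pt.
  by apply: nP; exists t.
have mab : measurable (`]a, b[%classic : set R) by [].
have [+ _] := negligibleP lebesgue_measure mab => /(_ nN).
rewrite [X in X = _]lebesgue_measure_itv /= lte_fin ab => -[/eqP].
by rewrite subr_eq0 gt_eqF.
Qed.

Lemma ae_imp (R : realType) (P Q : R -> Prop) :
  (forall t, P t -> Q t) ->
  {ae lebesgue_measure, forall t : R, P t} -> {ae lebesgue_measure, forall t : R, Q t}.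
Proof. by move=> PQ; apply: negligibleS => t /= nQ Pt; apply/nQ/PQ. Qed.

Lemma ae_imp2 (R : realType) (P Q S : R -> Prop) :
  (forall t, P t -> Q t -> S t) ->
  {ae lebesgue_measure, forall t : R, P t} -> {ae lebesgue_measure, forall t : R, Q t} ->
  {ae lebesgue_measure, forall t : R, S t}.
Proof.
move=> PQS aeP aeQ; apply: negligibleS (negligibleU aeP aeQ) => t /= nS.
have [Pt|nP] := pselect (P t); last by left.
by right => Qt; apply/nS/PQS.
Qed.

Lemma loc_abs_cont_close (R : realType) (n : nat) (x : R -> 'rV[R]_n) (t e : R) :
  loc_abs_cont x -> 0 <= t -> 0 < e -> exists2 d : R, 0 < d &
    forall s, 0 <= s -> `|s - t| < d -> dot (x s - x t) (x s - x t) < e.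
Proof.
move=> xac t0 e0.
have xtac : loc_abs_cont (fun s => x s - x t).
  by apply: loc_abs_contB => //; exact: loc_abs_cont_cst.
have t1 : 0 <= t + 1 by lra.
have [d d0 hd] := abs_cont_on_unif (abs_cont_on_sqnorm (lexx 0) t1 xtac) e0.
exists (Num.min d 1); first by rewrite lt_min d0 ltr01.
move=> s s0; rewrite lt_min => /andP[sd s1].
have := hd t s; rewrite subrr (_ : dot 0 0 = 0); last first.
  by rewrite -(scale0r (x t)) dotZl mul0r.
rewrite subr0 => H; apply: le_lt_trans (ler_norm _) (H _ _ sd); first by lra.
by move: s1; rewrite ltr_distl; lra.
Qed.

(** A curve outside [K] at time [t] stays outside for a while by continuity, and the interval after
    [t] is not negligible. *)
Lemma loc_abs_cont_ae_closed (R : realType) (n : nat) (K : set 'rV[R]_n) (x : R -> 'rV[R]_n) :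
  closed K -> loc_abs_cont x ->
  {ae lebesgue_measure, forall t : R, 0 < t -> K (x t)} ->
  forall t, 0 < t -> K (x t).
Proof.
move=> cK xac aeK t t0; apply: contrapT => nK.
have /nbhs_ballP[r /= r0 hr] : nbhs (x t) (~` K).
  by apply: open_nbhs_nbhs; split => //; exact: closed_openC.
have [d d0 hd] := loc_abs_cont_close xac (ltW t0) (exprn_gt0 2 r0).
have [|s /andP[ts sd] Ks] := ae_dense aeK (a := t) (b := t + d); first by rewrite ltrDl.
apply: (hr (x s)); last by apply: Ks; exact: lt_trans ts.
rewrite -ball_normE /= -normrN opprB; apply: norm_lt_dot => //.
by apply: hd; [lra | rewrite ger0_norm; lra].
Qed.

(** * Estimates for one player, and the energy of two *)

(* One player's half of the flow: x is the primal variable, z its proximal copy and ell c t the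
   cost of playing c at time t. The velocities enter only through their variational inequalities. *)
Definition prox_flow (R : realType) (n : nat) (K : set 'rV[R]_n) (ell : 'rV[R]_n -> R -> R)
    (rho : R) (x z : R -> 'rV[R]_n) : Prop :=
  [/\ loc_abs_cont x, loc_abs_cont z,
      forall t, 0 <= t -> K (x t), forall t, 0 <= t -> K (z t) &
      {ae lebesgue_measure, forall t : R, 0 < t ->
         [/\ derivable x t 1, derivable z t 1,
             forall c, K c -> dot (derive1 x t) (x t - c) <=
               ell c t - ell (x t) t - rho^-1 * dot (x t - z t) (x t - c) &
             forall c, K c -> dot (derive1 z t) (z t - c) <=
               rho^-1 * dot (x t - z t) (z t - c)]}].

Lemma is_derive_sqdist (R : realType) (n : nat) (x z : R -> 'rV[R]_n) (t : R) :
  derivable x t 1 -> derivable z t 1 ->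
  is_derive t 1 (fun s => dot (x s - z s) (x s - z s))
    (2 * dot (derive1 x t - derive1 z t) (x t - z t)).
Proof.
move=> dx dz; have X i := derive1_coord i dx; have Z i := derive1_coord i dz.
rewrite (_ : (fun s => _) = \sum_(i < n) (fun s =>
    (x s ord0 i - z s ord0 i) * (x s ord0 i - z s ord0 i))); last first.
  by apply/funext => s; rewrite fct_sumE; apply: eq_bigr => i _; rewrite !mxE.
apply: is_derive_eq; rewrite mulr_sumr; apply: eq_bigr => i _.
by rewrite !mxE /GRing.scale /=; ring.
Qed.

Lemma is_derive_sqdist_cst (R : realType) (n : nat) (x : R -> 'rV[R]_n) (c : 'rV[R]_n) (t : R) :
  derivable x t 1 ->
  is_derive t 1 (fun s => dot (x s - c) (x s - c)) (2 * dot (derive1 x t) (x t - c)).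
Proof.
move=> dx; have X i := derive1_coord i dx.
rewrite (_ : (fun s => _) = \sum_(i < n) (fun s =>
    (x s ord0 i - c ord0 i) * (x s ord0 i - c ord0 i))); last first.
  by apply/funext => s; rewrite fct_sumE; apply: eq_bigr => i _; rewrite !mxE.
apply: is_derive_eq; rewrite mulr_sumr; apply: eq_bigr => i _.
by rewrite !mxE /GRing.scale /=; ring.
Qed.

Lemma prox_flow_primal_increment (R : realType) (n : nat) (K : set 'rV[R]_n)
    (ell : 'rV[R]_n -> R -> R) (rho : R) (x z : R -> 'rV[R]_n) (c : 'rV[R]_n) (a b M : R) :
  prox_flow K ell rho x z -> K c -> 0 <= a -> a <= b ->
  (forall t, a < t < b ->
     ell c t - ell (x t) t - rho^-1 * dot (x t - z t) (x t - c) <= M) ->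
  dot (x b - c) (x b - c) - dot (x a - c) (x a - c) <= 2 * M * (b - a).
Proof.
move=> [xac _ _ _ ae] Kc a0 ab HM.
apply: (abs_cont_increment_le ab (f := fun t => dot (x t - c) (x t - c))).
  apply: (abs_cont_on_sqnorm a0 ab (x := fun t => x t - c)).
  by apply: loc_abs_contB => //; exact: loc_abs_cont_cst.
apply: ae_imp ae => t Ht /andP[at_ tb]; have [dx _ Hx _] := Ht (le_lt_trans a0 at_).
exists (2 * dot (derive1 x t) (x t - c)); first exact: is_derive_sqdist_cst.
rewrite ler_pM2l //; apply: le_trans (Hx c Kc) _; apply: HM.
by rewrite at_.
Qed.

Lemma prox_flow_copy_increment (R : realType) (n : nat) (K : set 'rV[R]_n)
    (ell : 'rV[R]_n -> R -> R) (rho : R) (x z : R -> 'rV[R]_n) (c : 'rV[R]_n) (a b M : R) :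
  prox_flow K ell rho x z -> K c -> 0 <= a -> a <= b ->
  (forall t, a < t < b -> rho^-1 * dot (x t - z t) (z t - c) <= M) ->
  dot (z b - c) (z b - c) - dot (z a - c) (z a - c) <= 2 * M * (b - a).
Proof.
move=> [_ zac _ _ ae] Kc a0 ab HM.
apply: (abs_cont_increment_le ab (f := fun t => dot (z t - c) (z t - c))).
  apply: (abs_cont_on_sqnorm a0 ab (x := fun t => z t - c)).
  by apply: loc_abs_contB => //; exact: loc_abs_cont_cst.
apply: ae_imp ae => t Ht /andP[at_ tb]; have [_ dz _ Hz] := Ht (le_lt_trans a0 at_).
exists (2 * dot (derive1 z t) (z t - c)); first exact: is_derive_sqdist_cst.
rewrite ler_pM2l //; apply: le_trans (Hz c Kc) _; apply: HM.
by rewrite at_.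
Qed.

(* Testing the inequality for x against z and conversely makes the regularization terms add up
   to -2|x - z|^2/rho. *)
Lemma prox_flow_gap_increment (R : realType) (n : nat) (K : set 'rV[R]_n)
    (ell : 'rV[R]_n -> R -> R) (rho : R) (x z : R -> 'rV[R]_n) (a b M : R) :
  prox_flow K ell rho x z -> 0 < rho -> 0 <= a -> a <= b ->
  (forall t, a < t < b -> ell (z t) t - ell (x t) t <= M) ->
  dot (x b - z b) (x b - z b) - dot (x a - z a) (x a - z a) <= 2 * M * (b - a).
Proof.
move=> [xac zac Kx Kz ae] rho0 a0 ab HM.
apply: (abs_cont_increment_le ab (f := fun t => dot (x t - z t) (x t - z t))).
  exact: (abs_cont_on_sqnorm a0 ab (loc_abs_contB xac zac)).
apply: ae_imp ae => t Ht /andP[at_ tb]; have t0 := le_lt_trans a0 at_.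
have [dx dz Hx Hz] := Ht t0.
exists (2 * dot (derive1 x t - derive1 z t) (x t - z t)); first exact: is_derive_sqdist.
rewrite ler_pM2l //.
have := Hx _ (Kz t (ltW t0)); have := Hz _ (Kx t (ltW t0)).
rewrite -(opprB (x t) (z t)) !dotNr (dotDl (derive1 x t)) (dotNl (derive1 z t)).
have := mulr_ge0 (_ : 0 <= rho^-1) (dot_ge0 (x t - z t)).
rewrite invr_ge0 ltW // => /(_ isT).
by have := HM t; rewrite at_ tb => /(_ isT); lra.
Qed.

Definition prox_energy (R : realType) (n : nat) (x z : R -> 'rV[R]_n) (c : 'rV[R]_n) (t : R) : R :=
  dot (x t - c) (x t - c) + dot (z t - c) (z t - c).

(** With [c] tested in both inequalities of a player, the regularization terms combine to -<x - z,
    (x - c) - (z - c)>/rho = -|x - z|^2/rho. The cost differences are only assumed nonpositive after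
    summing over the two players, which is what a saddle point provides. *)
Lemma prox_flow_lyapunov (R : realType) (n m : nat) (K : set 'rV[R]_n) (V : set 'rV[R]_m)
    (ell : 'rV[R]_n -> R -> R) (ell' : 'rV[R]_m -> R -> R) (rho : R)
    (x z : R -> 'rV[R]_n) (y w : R -> 'rV[R]_m) (c : 'rV[R]_n) (d : 'rV[R]_m) (a b mu : R) :
  prox_flow K ell rho x z -> prox_flow V ell' rho y w -> 0 < rho -> K c -> V d ->
  0 <= a -> a <= b ->
  (forall t, 0 <= t -> ell c t - ell (x t) t + (ell' d t - ell' (y t) t) <= 0) ->
  (forall t, a < t < b -> mu <= dot (x t - z t) (x t - z t) + dot (y t - w t) (y t - w t)) ->
  (prox_energy x z c b + prox_energy y w d b) - (prox_energy x z c a + prox_energy y w d a) <=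
    - (2 * rho^-1 * mu) * (b - a).
Proof.
move=> [xac zac Kx Kz aex] [yac wac Vy Vw aey] rho0 Kc Vd a0 ab Hell Hmu.
pose W t := prox_energy x z c t + prox_energy y w d t.
have sub k (u : R -> 'rV[R]_k) e : loc_abs_cont u ->
    abs_cont_on a b (fun t => dot (u t - e) (u t - e)).
  move=> uac; apply: (abs_cont_on_sqnorm a0 ab (x := fun t => u t - e)).
  by apply: loc_abs_contB => //; exact: loc_abs_cont_cst.
apply: (abs_cont_increment_le ab (f := W)).
  by rewrite /W /prox_energy; apply: abs_cont_onD; apply: abs_cont_onD; exact: sub.
apply: (ae_imp2 _ aex aey) => t Hx Hy /andP[at_ tb].
have t0 := le_lt_trans a0 at_.
have [dx dz X Z] := Hx t0; have [dy dw Y Wd] := Hy t0.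
have dX := is_derive_sqdist_cst c dx; have dZ := is_derive_sqdist_cst c dz.
have dY := is_derive_sqdist_cst d dy; have dW := is_derive_sqdist_cst d dw.
eexists; first by rewrite /W /prox_energy; exact: (is_deriveD (is_deriveD dX dZ) (is_deriveD dY dW)).
have := X c Kc; have := Z c Kc; have := Y d Vd; have := Wd d Vd.
have splt k (u v e : 'rV[R]_k) : dot (u - v) (u - v) = dot (u - v) (u - e) - dot (u - v) (v - e).
  by rewrite -dotNr -dotDr; congr (dot _ _); apply/rowP => i; rewrite !mxE; ring.
have := Hmu t; rewrite at_ tb => /(_ isT).
rewrite (splt _ _ _ c) (splt _ (y t) _ d) => H1.
have : rho^-1 * mu <= rho^-1 * (dot (x t - z t) (x t - c) - dot (x t - z t) (z t - c) +
     (dot (y t - w t) (y t - d) - dot (y t - w t) (w t - d))).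
  by rewrite ler_pM2l ?invr_gt0.
by have := Hell t (ltW t0); lra.
Qed.

(** * Vanishing dissipation and its consequences for one player *)

(* Barbalat's argument run backwards in time: D grows at most linearly, so a large value of D
   at t keeps D large just before t, which costs W a fixed amount. *)
Lemma dissipation_vanishes (R : realType) (W D : R -> R) (k M : R) :
  0 < k -> 0 < M -> (forall t, 0 <= t -> 0 <= W t) ->
  (forall a b, 0 <= a -> a <= b -> D b - D a <= M * (b - a)) ->
  (forall t, 0 <= t -> 0 <= D t) ->
  (forall a b mu, 0 <= a -> a <= b -> (forall t, a < t < b -> mu <= D t) ->
     W b - W a <= - (k * mu) * (b - a)) ->
  forall e, 0 < e -> exists2 T : R, 0 <= T & forall t, T <= t -> D t < e.
Proof.
move=> k0 M0 W0 DM D0 WD e e0; apply: contrapT => nT.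
pose S := [set W t | t in [set t | 0 <= t]].
have hS : has_inf S.
  split; first by exists (W 0), 0 => /=.
  by exists 0 => _ [t t0 <-]; exact: W0.
(* With growth rate at most [M], a value [D t >= e] keeps [D >= e / 2] on the preceding interval of
   length [dl]. There [W] loses [k * (e / 2) * dl], more than what remains above its infimum after
   [T]. *)
pose dl := e / 2 / M; have dl0 : 0 < dl by rewrite !divr_gt0.
have kd : 0 < k * (e / 2) * dl by rewrite mulr_gt0 // mulr_gt0 // divr_gt0.
have [_ [T T0 <-] WT] := inf_adherent kd hS.
have [t Tt De] : exists2 t, T + dl <= t & e <= D t.
  apply: contrapT => nt; apply: nT; exists (T + dl); first by rewrite addr_ge0 // ltW.
  by move=> t Tt; rewrite ltNge; apply/negP => et; apply: nt; exists t.
have t0 : 0 <= t by move: T0 => /=; lra.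
have td0 : 0 <= t - dl by move: T0 => /=; lra.
have H1 : W t - W (t - dl) <= - (k * (e / 2)) * (t - (t - dl)).
  apply: WD => //; first by lra.
  move=> s /andP[ts st].
  have := DM s t; rewrite (ltW st) (le_trans td0 (ltW ts)) => /(_ isT isT).
  have : M * (t - s) <= M * dl by rewrite ler_pM2l //; lra.
  have -> : M * dl = e / 2 by rewrite mulrC divfK // gt_eqF.
  by lra.
have H2 : W (t - dl) - W T <= - (k * 0) * (t - dl - T).
  apply: WD => //; first by lra.
  by move=> s /andP[Ts _]; apply: D0; apply: le_trans T0 (ltW Ts).
have H3 : inf S <= W t by apply: inf_lbound => //; [exact: hS.2 | exists t].
by rewrite mulr0 oppr0 mul0r in H2; lra.
Qed.

Lemma sqdist_triangle (R : realType) (n : nat) (u v w : 'rV[R]_n) :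
  dot (u - w) (u - w) <= 2 * dot (u - v) (u - v) + 2 * dot (v - w) (v - w).
Proof.
have -> : u - w = (u - v) + (v - w) by rewrite addrA subrK.
have := dot_ge0 ((u - v) - (v - w)).
set a := u - v; set b := v - w.
by rewrite (dot_sqrD a b) (dot_sqrD a (- b)) !dotNr dotNl; lra.
Qed.

Lemma sqdistC (R : realType) (n : nat) (u v : 'rV[R]_n) :
  dot (u - v) (u - v) = dot (v - u) (v - u).
Proof. by rewrite -(opprB v u) dotNl dotNr opprK. Qed.

Lemma dot_small (R : realType) (n : nat) (B e : R) : 0 < B -> 0 < e ->
  exists2 dl : R, 0 < dl & forall u v : 'rV[R]_n,
    dot u u < dl -> dot v v <= B -> dot u v <= e.
Proof.
(* Young's inequality with weight [B / e] and [dl = e^2 / B] makes each of its two terms at most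
   [e / 2]. *)
move=> B0 e0; have k0 : 0 < B / e by rewrite divr_gt0.
exists (e / (B / e)); first by rewrite divr_gt0.
move=> u v; rewrite ltr_pdivlMr // => hu hv; apply: le_trans (dot_young u v k0) _.
have : (2 * (B / e))^-1 * dot v v <= (2 * (B / e))^-1 * B.
  by rewrite ler_wpM2l // invr_ge0 mulr_ge0 // ltW.
have -> : (2 * (B / e))^-1 * B = e / 2 by field; rewrite !gt_eqF.
by lra.
Qed.

(** One-sided, since it is applied to nonnegative quantities: convergence to 0 at infinity. *)
Definition vanishes (R : realType) (f : R -> R) : Prop :=
  forall e, 0 < e -> exists2 T : R, 0 <= T & forall t, T <= t -> f t < e.

(** The point [z t] lies in [K], so it can itself be the test point: |z - z t|^2 grows at rate at
    most (2/rho)<x - z, z - z t>, a vanishing factor against a bounded one. The point [c] only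
    centres the bound. *)
Lemma prox_flow_copy_settles (R : realType) (n : nat) (K : set 'rV[R]_n)
    (ell : 'rV[R]_n -> R -> R) (rho : R) (x z : R -> 'rV[R]_n) (c : 'rV[R]_n) (B e : R) :
  prox_flow K ell rho x z -> 0 < rho ->
  vanishes (fun t => dot (x t - z t) (x t - z t)) ->
  (forall t, 0 <= t -> prox_energy x z c t <= B) -> 0 < e ->
  exists2 T : R, 0 <= T & forall t s, T <= t -> t <= s -> s <= t + 1 ->
    dot (z s - z t) (z s - z t) <= e.
Proof.
move=> fl rho0 van HB e0.
have zB t : 0 <= t -> dot (z t - c) (z t - c) <= B.
  by move=> t0; have := HB t t0; have := dot_ge0 (x t - c); rewrite /prox_energy; lra.
have B0 : 0 <= B by apply: le_trans (zB 0 (lexx 0)); exact: dot_ge0.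
have re : 0 < rho * (e / 2) by rewrite mulr_gt0 // divr_gt0.
(* Two points at squared distance at most [B] from [c] are at squared distance at most [4 * B] from
   each other. *)
have B1 : 0 < 4 * B + 1 by lra.
have [dl dl0 Hdl] := @dot_small R n _ _ B1 re.
have [T T0 HT] := van _ dl0; exists T => // t s Tt ts st.
have t0 : 0 <= t by exact: le_trans Tt.
have [_ _ _ Kz _] := fl.
have := prox_flow_copy_increment (M := e / 2) fl (Kz t t0) t0 ts.
rewrite subrr [X in _ - X](_ : _ = 0) ?subr0; last by rewrite -(scale0r (z t)) dotZl mul0r.
move=> H; apply: le_trans (H _) _; last first.
  have -> : 2 * (e / 2) = e by field.
  by rewrite ler_piMr //; lra.
move=> v /andP[tv vs]; rewrite mulrC ler_pdivrMr // mulrC.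
have v0 : 0 <= v by lra.
apply: Hdl; first by apply: HT; lra.
apply: le_trans (sqdist_triangle _ c _) _.
by have := zB v v0; have := zB t t0; rewrite (sqdistC c); lra.
Qed.

Lemma prox_flow_primal_settles (R : realType) (n : nat) (K : set 'rV[R]_n)
    (ell : 'rV[R]_n -> R -> R) (rho : R) (x z : R -> 'rV[R]_n) (c : 'rV[R]_n) (B e : R) :
  prox_flow K ell rho x z -> 0 < rho ->
  vanishes (fun t => dot (x t - z t) (x t - z t)) ->
  (forall t, 0 <= t -> prox_energy x z c t <= B) -> 0 < e ->
  exists2 T : R, 0 <= T & forall t s, T <= t -> t <= s -> s <= t + 1 ->
    dot (x s - x t) (x s - x t) <= e.
Proof.
move=> fl rho0 van HB e0.
(* Going from [x s] through [z s] and [z t] to [x t] costs 2 + 2 * (2 + 2) = 10 times the common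
   bound. *)
have e10 : 0 < e / 10 by rewrite divr_gt0.
have [T T0 HT] := prox_flow_copy_settles fl rho0 van HB e10.
have [|T' T0' HT'] := van (e / 10); first by rewrite divr_gt0.
exists (Num.max T T'); first by rewrite le_max T0.
move=> t s; rewrite ge_max => /andP[Tt Tt'] ts st.
have := sqdist_triangle (x s) (z s) (x t); have := sqdist_triangle (z s) (z t) (x t).
have := HT t s Tt ts st; have := HT' s (le_trans Tt' ts); have := HT' t Tt'.
by rewrite (sqdistC (z t)); lra.
Qed.

(** A gain of [eta] throughout a unit window would pull x towards [c] by a definite amount, although
    late in time x hardly moves within such a window. Here [c0] centres the bound and [c] is the
    deviation. *)
Lemma prox_flow_no_gain (R : realType) (n : nat) (K : set 'rV[R]_n)
    (ell : 'rV[R]_n -> R -> R) (rho : R) (x z : R -> 'rV[R]_n) (c0 c : 'rV[R]_n) (B eta : R) :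
  prox_flow K ell rho x z -> 0 < rho ->
  vanishes (fun t => dot (x t - z t) (x t - z t)) ->
  (forall t, 0 <= t -> prox_energy x z c0 t <= B) -> K c -> 0 < eta ->
  exists2 T : R, 0 <= T & forall t, T <= t ->
    ~ (forall s, t < s < t + 1 -> ell c s - ell (x s) s <= - eta).
Proof.
move=> fl rho0 van HB Kc eta0.
have xB t : 0 <= t -> dot (x t - c) (x t - c) <= 2 * B + 2 * dot (c0 - c) (c0 - c).
  move=> t0; have := HB t t0; have := dot_ge0 (z t - c0); rewrite /prox_energy.
  by have := sqdist_triangle (x t) c0 c; lra.
have B1 : 0 < 2 * B + 2 * dot (c0 - c) (c0 - c) + 1.
  by have := xB 0 (lexx 0); have := dot_ge0 (x 0 - c); lra.
(* The regularization term may consume half of the gain, so |x - c|^2 would drop by [eta] over the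
   window, while settling permits a drop of at most [eta / 4]. *)
have re : 0 < rho * (eta / 2) by rewrite mulr_gt0 // divr_gt0.
have e8 : 0 < eta / 8 by rewrite divr_gt0.
have [dl dl0 Hdl] := @dot_small R n _ _ B1 re.
have [dl' dl0' Hdl'] := @dot_small R n _ _ B1 e8.
have [T T0 HT] := van _ dl0.
have dl2 : 0 < dl' / 2 by rewrite divr_gt0.
have [T' T0' HT'] := prox_flow_primal_settles fl rho0 van HB dl2.
exists (Num.max T T'); first by rewrite le_max T0.
move=> t; rewrite ge_max => /andP[Tt Tt'] Hg.
have t0 : 0 <= t by exact: le_trans Tt.
have t1 : t <= t + 1 by lra.
have inc : dot (x (t + 1) - c) (x (t + 1) - c) - dot (x t - c) (x t - c) <=
    2 * - (eta / 2) * (t + 1 - t).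
  apply: (prox_flow_primal_increment fl Kc t0 t1) => s /andP[ts st].
  have := Hg s; rewrite ts st => /(_ isT).
  have : dot (z s - x s) (x s - c) <= rho * (eta / 2).
    apply: Hdl; first by rewrite sqdistC; apply: HT; lra.
    by apply: le_trans (xB s _) _; lra.
  rewrite mulrC -ler_pdivrMr // mulrC -(opprB (x s)) dotNl; lra.
have h1 : dot (x t - x (t + 1)) (x t - c) <= eta / 8.
  apply: Hdl'; last by apply: le_trans (xB t t0) _; lra.
  by rewrite sqdistC; apply: le_lt_trans (HT' t (t + 1) Tt' t1 (lexx _)) _; lra.
have h2 : dot (x (t + 1) - c) (x (t + 1) - c) = dot (x t - c) (x t - c)
    - 2 * dot (x t - x (t + 1)) (x t - c) + dot (x (t + 1) - x t) (x (t + 1) - x t).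
  have -> : x (t + 1) - c = (x t - c) + (x (t + 1) - x t).
    by apply/rowP => i; rewrite !mxE; ring.
  rewrite dot_sqrD -(opprB (x (t + 1)) (x t)) dotNl (dotC (x t - c)); ring.
have h3 := dot_ge0 (x (t + 1) - x t).
by rewrite h2 in inc; lra.
Qed.

(** * The coupled flow: energy and gap *)

(** The maximizing player is given the cost -L, so the one-player estimates apply to both; each cost
    depends on time through the trajectory of the opponent. *)
Definition saddle_flow (R : realType) (n m : nat) (K : set 'rV[R]_n) (V : set 'rV[R]_m)
    (L : 'rV[R]_n -> 'rV[R]_m -> R) (rho : R)
    (x z : R -> 'rV[R]_n) (y w : R -> 'rV[R]_m) : Prop :=
  prox_flow K (fun c t => L c (y t)) rho x z /\
  prox_flow V (fun d t => - L (x t) d) rho y w.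

(** Convexity and concavity replace the gradient in the variational inequalities by cost
    differences; from here on L enters through its values and its continuity. *)
Lemma rsf_solution_saddle_flow (R : realType) (n m : nat)
    (K : set 'rV[R]_n) (V : set 'rV[R]_m) (L : 'rV[R]_n -> 'rV[R]_m -> R)
    (rho : R) (x z : R -> 'rV[R]_n) (y w : R -> 'rV[R]_m) :
  closed K -> convex_set K -> closed V -> convex_set V -> C1 L ->
  (forall y0, convex_fun (fun x0 => L x0 y0)) ->
  (forall x0, concave_fun (fun y0 => L x0 y0)) ->
  K (x 0) -> K (z 0) -> V (y 0) -> V (w 0) ->
  rsf_solution K V L rho x z y w -> saddle_flow K V L rho x z y w.
Proof.
move=> cK vK cV vV cL Lx Ly Kx0 Kz0 Vy0 Vw0 [xac [zac [yac [wac ae]]]].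
have nK : K !=set0 by exists (x 0).
have nV : V !=set0 by exists (y 0).
have inv k (S : set 'rV[R]_k) (u : R -> 'rV[R]_k) : closed S -> loc_abs_cont u -> S (u 0) ->
    {ae lebesgue_measure, forall t : R, 0 < t -> S (u t)} -> forall t, 0 <= t -> S (u t).
  move=> cS uac S0 aeS t; rewrite le_eqVlt => /orP[/eqP <- //|].
  exact: (loc_abs_cont_ae_closed cS uac aeS).
split; split => //.
- apply: inv => //; apply: ae_imp ae => t H /H[_ [p _ _ _]].
  by have [] := vf_proj_variational cK vK nK p.
- apply: inv => //; apply: ae_imp ae => t H /H[_ [_ p _ _]].
  by have [] := vf_proj_variational cK vK nK p.
- apply: ae_imp ae => t H /H[[dx dz _ _] [px pz _ _]].
  have [_ X] := vf_proj_variational cK vK nK px.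
  have [_ Z] := vf_proj_variational cK vK nK pz.
  split=> // c Kc; last by apply: le_trans (Z c Kc) _; rewrite dotZl.
  apply: le_trans (X c Kc) _; have := @gradx_le R n m L (x t) (y t) c cL (Lx _).
  by rewrite (dotDl (- _)) !dotNl dotZl -(opprB (x t) c) dotNr; lra.
- apply: inv => //; apply: ae_imp ae => t H /H[_ [_ _ p _]].
  by have [] := vf_proj_variational cV vV nV p.
- apply: inv => //; apply: ae_imp ae => t H /H[_ [_ _ _ p]].
  by have [] := vf_proj_variational cV vV nV p.
- apply: ae_imp ae => t H /H[[_ _ dy dw] [_ _ py pw]].
  have [_ Y] := vf_proj_variational cV vV nV py.
  have [_ W] := vf_proj_variational cV vV nV pw.
  split=> // d Vd; last by apply: le_trans (W d Vd) _; rewrite dotZl.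
  apply: le_trans (Y d Vd) _; have := @grady_ge R n m L (x t) (y t) d cL (Ly _).
  by rewrite (dotDl (grady L _ _)) dotNl dotZl -(opprB (y t) d) dotNr; lra.
Qed.

Definition saddle_energy (R : realType) (n m : nat) (x z : R -> 'rV[R]_n) (y w : R -> 'rV[R]_m)
    (xs : 'rV[R]_n) (ys : 'rV[R]_m) (t : R) : R :=
  prox_energy x z xs t + prox_energy y w ys t.

Definition saddle_gap (R : realType) (n m : nat) (x z : R -> 'rV[R]_n) (y w : R -> 'rV[R]_m)
    (t : R) : R :=
  dot (x t - z t) (x t - z t) + dot (y t - w t) (y t - w t).

Lemma prox_energy_ge0 (R : realType) (n : nat) (x z : R -> 'rV[R]_n) (c : 'rV[R]_n) (t : R) :
  0 <= prox_energy x z c t.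
Proof. by rewrite addr_ge0 // dot_ge0. Qed.

(** In the sum of the two cost differences L(x, y) cancels, leaving L(xs, y) - L(x, ys), which is
    nonpositive by comparison with L(xs, ys). *)
Lemma saddle_energy_decrease (R : realType) (n m : nat) (K : set 'rV[R]_n) (V : set 'rV[R]_m)
    (L : 'rV[R]_n -> 'rV[R]_m -> R) (rho : R) (x z : R -> 'rV[R]_n) (y w : R -> 'rV[R]_m)
    (xs : 'rV[R]_n) (ys : 'rV[R]_m) (a b mu : R) :
  saddle_flow K V L rho x z y w -> 0 < rho -> saddle_point K V L xs ys ->
  0 <= a -> a <= b -> (forall t, a < t < b -> mu <= saddle_gap x z y w t) ->
  saddle_energy x z y w xs ys b - saddle_energy x z y w xs ys a <=
    - (2 * rho^-1 * mu) * (b - a).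
Proof.
move=> [fx fy] rho0 [Kxs [Vys sad]] a0 ab Hmu.
apply: (prox_flow_lyapunov fx fy rho0 Kxs Vys a0 ab) => // t t0.
have [_ _ Kx _ _] := fx; have [_ _ Vy _ _] := fy.
by have := sad (x t) (y t) (Kx t t0) (Vy t t0); lra.
Qed.

Lemma saddle_energy_le (R : realType) (n m : nat) (K : set 'rV[R]_n) (V : set 'rV[R]_m)
    (L : 'rV[R]_n -> 'rV[R]_m -> R) (rho : R) (x z : R -> 'rV[R]_n) (y w : R -> 'rV[R]_m)
    (xs : 'rV[R]_n) (ys : 'rV[R]_m) (a b : R) :
  saddle_flow K V L rho x z y w -> 0 < rho -> saddle_point K V L xs ys ->
  0 <= a -> a <= b -> saddle_energy x z y w xs ys b <= saddle_energy x z y w xs ys a.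
Proof.
move=> fl rho0 sad a0 ab; rewrite -subr_le0.
have := saddle_energy_decrease (mu := 0) fl rho0 sad a0 ab.
rewrite mulr0 oppr0 mul0r; apply=> t _; by rewrite addr_ge0 // dot_ge0.
Qed.

Lemma continuous_ball_bounded (R : realType) (n m : nat) (F : 'rV[R]_n * 'rV[R]_m -> R)
    (xs : 'rV[R]_n) (ys : 'rV[R]_m) (B : R) :
  continuous F -> 0 <= B -> exists M : R, forall u v,
    dot (u - xs) (u - xs) <= B -> dot (v - ys) (v - ys) <= B -> F (u, v) <= M.
Proof.
move=> cF B0.
pose A := [set u : 'rV[R]_n | dot (u - xs) (u - xs) <= B].
pose A' := [set u : 'rV[R]_m | dot (u - ys) (u - ys) <= B].
have cA : compact A by apply: bounded_closed_compact; [exact: bounded_sqdist_le|exact: closed_sqdist_le].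
have cA' : compact A' by apply: bounded_closed_compact; [exact: bounded_sqdist_le|exact: closed_sqdist_le].
have z k (c : 'rV[R]_k) : dot (c - c) (c - c) <= B.
  by rewrite subrr (_ : dot 0 0 = 0) // -(scale0r c) dotZl mul0r.
have [|||q qA qmax] := @compact_EVT_max _ R F (A `*` A').
- by exists (xs, ys); split; exact: z.
- exact: compact_setX.
- exact: continuous_subspaceT.
by exists (F q) => u v hu hv; apply: qmax; rewrite inE; split.
Qed.

Lemma saddle_gap_vanishes (R : realType) (n m : nat) (K : set 'rV[R]_n) (V : set 'rV[R]_m)
    (L : 'rV[R]_n -> 'rV[R]_m -> R) (rho : R) (x z : R -> 'rV[R]_n) (y w : R -> 'rV[R]_m)
    (xs : 'rV[R]_n) (ys : 'rV[R]_m) :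
  saddle_flow K V L rho x z y w -> 0 < rho -> C1 L -> saddle_point K V L xs ys ->
  vanishes (saddle_gap x z y w).
Proof.
move=> fl rho0 cL sad.
pose B := saddle_energy x z y w xs ys 0.
have HB t : 0 <= t -> [/\ dot (x t - xs) (x t - xs) <= B, dot (z t - xs) (z t - xs) <= B,
    dot (y t - ys) (y t - ys) <= B & dot (w t - ys) (w t - ys) <= B].
  move=> t0; have := saddle_energy_le fl rho0 sad (lexx 0) t0.
  rewrite -/B /saddle_energy /prox_energy.
  have := dot_ge0 (x t - xs); have := dot_ge0 (z t - xs).
  have := dot_ge0 (y t - ys); have := dot_ge0 (w t - ys).
  by split; lra.
have B0 : 0 <= B by have [h _ _ _] := HB 0 (lexx 0); exact: le_trans (dot_ge0 _) h.
have cF := C1_continuous cL.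
have [M1 HM1] := continuous_ball_bounded xs ys cF B0.
have cF' : continuous (fun q : 'rV[R]_n * 'rV[R]_m => - L q.1 q.2).
  by move=> q; apply: cvgN; exact: cF.
have [M2 HM2] := continuous_ball_bounded xs ys cF' B0.
(* The energy confines all four curves to balls on which [M1] bounds L and [M2] bounds -L, so a cost
   difference is at most [M1 + M2]. Each half of the gap then grows at rate at most [2 * M]. *)
pose M := `|M1| + `|M2| + 1.
have M12 : M1 + M2 <= M.
  by have := ler_norm M1; have := ler_norm M2; rewrite /M; lra.
have M0 : 0 < 4 * M by rewrite mulr_gt0 // ltr_wpDl // addr_ge0.
have k0 : 0 < 2 * rho^-1 by rewrite mulr_gt0 ?invr_gt0.
apply: (dissipation_vanishes (W := saddle_energy x z y w xs ys) k0 M0).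
- by move=> t _; rewrite addr_ge0 // prox_energy_ge0.
- move=> a b a0 ab; have [fx fy] := fl.
  have gx : dot (x b - z b) (x b - z b) - dot (x a - z a) (x a - z a) <= 2 * M * (b - a).
    apply: (prox_flow_gap_increment fx rho0 a0 ab) => t /andP[at_ _].
    have [hx hz hy hw] := HB t (le_trans a0 (ltW at_)).
    by have := HM1 _ _ hz hy; have := HM2 _ _ hx hy; rewrite /=; lra.
  have gy : dot (y b - w b) (y b - w b) - dot (y a - w a) (y a - w a) <= 2 * M * (b - a).
    apply: (prox_flow_gap_increment fy rho0 a0 ab) => t /andP[at_ _].
    have [hx hz hy hw] := HB t (le_trans a0 (ltW at_)).
    by have := HM1 _ _ hx hy; have := HM2 _ _ hx hw; rewrite /=; lra.
  by rewrite /saddle_gap; lra.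
- by move=> t _; rewrite addr_ge0 // dot_ge0.
- move=> a b mu a0 ab Hmu; exact: (saddle_energy_decrease fl rho0 sad a0 ab Hmu).
Qed.

(** * Cluster points of the trajectory are saddle points *)

Lemma near_sqdist_lt (R : realType) (n : nat) (c : 'rV[R]_n) (r : R) : 0 < r ->
  nbhs c [set u : 'rV[R]_n | dot (u - c) (u - c) < r].
Proof.
move=> r0; have H := @continuous_sqdist R n c c.
apply: (cvgr_lt _ H); rewrite subrr (_ : dot 0 0 = 0) //.
by rewrite -(scale0r c) dotZl mul0r.
Qed.

Lemma nbhs_sqdistP (R : realType) (n : nat) (c : 'rV[R]_n) (A : set 'rV[R]_n) :
  nbhs c A -> exists2 r : R, 0 < r & forall u, dot (u - c) (u - c) < r -> A u.
Proof.
move=> /nbhs_ballP[r /= r0 hr]; exists (r ^+ 2); first exact: exprn_gt0.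
move=> u hu; apply: hr; rewrite -ball_normE /= -normrN opprB.
exact: norm_lt_dot.
Qed.

Lemma cluster_pair_pinfty (R : realType) (n m : nat) (x : R -> 'rV[R]_n) (y : R -> 'rV[R]_m)
    (xs : 'rV[R]_n) (ys : 'rV[R]_m) (B : R) :
  (forall t, 0 <= t -> dot (x t - xs) (x t - xs) <= B /\ dot (y t - ys) (y t - ys) <= B) ->
  exists xb yb, forall r T : R, 0 < r -> exists2 t : R, T <= t &
    dot (x t - xb) (x t - xb) < r /\ dot (y t - yb) (y t - yb) < r.
Proof.
move=> HB.
pose A := [set u : 'rV[R]_n | dot (u - xs) (u - xs) <= B].
pose A' := [set u : 'rV[R]_m | dot (u - ys) (u - ys) <= B].
have cA : compact A by apply: bounded_closed_compact; [exact: bounded_sqdist_le|exact: closed_sqdist_le].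
have cA' : compact A' by apply: bounded_closed_compact; [exact: bounded_sqdist_le|exact: closed_sqdist_le].
have FA : ((fun t => (x t, y t)) @ +oo%R) (A `*` A').
  exists (0 : R); split; first exact: num_real.
  by move=> t t0; apply: HB; exact: ltW.
have [[xb yb] [_ cl]] := compact_setX cA cA' (F := (fun t => (x t, y t)) @ +oo%R) _ FA.
exists xb, yb => r T r0.
pose P := [set u : 'rV[R]_n | dot (u - xb) (u - xb) < r].
pose Q := [set v : 'rV[R]_m | dot (v - yb) (v - yb) < r].
have [|| [u v] [[t [Tt [<- <-]]] [/= hu hv]]] :=
  cl [set q | exists t, T <= t /\ (x t, y t) = q] (P `*` Q).
- exists (T : R); split; first exact: num_real.
  by move=> t Tt; exists t; split=> //; exact: ltW.
- exists (P, Q) => //.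
  by split; exact: near_sqdist_lt.
by exists t.
Qed.

Lemma saddle_flow_bounded (R : realType) (n m : nat) (K : set 'rV[R]_n) (V : set 'rV[R]_m)
    (L : 'rV[R]_n -> 'rV[R]_m -> R) (rho : R) (x z : R -> 'rV[R]_n) (y w : R -> 'rV[R]_m)
    (xs : 'rV[R]_n) (ys : 'rV[R]_m) :
  saddle_flow K V L rho x z y w -> 0 < rho -> saddle_point K V L xs ys ->
  exists B : R, forall t, 0 <= t -> prox_energy x z xs t <= B /\ prox_energy y w ys t <= B.
Proof.
move=> fl rho0 sad; exists (saddle_energy x z y w xs ys 0) => t t0.
have := saddle_energy_le fl rho0 sad (lexx 0) t0; rewrite {1}/saddle_energy.
by have := prox_energy_ge0 x z xs t; have := prox_energy_ge0 y w ys t; split; lra.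
Qed.

Lemma saddle_gap_vanishes2 (R : realType) (n m : nat) (x z : R -> 'rV[R]_n) (y w : R -> 'rV[R]_m) :
  vanishes (saddle_gap x z y w) ->
  vanishes (fun t => dot (x t - z t) (x t - z t)) /\ vanishes (fun t => dot (y t - w t) (y t - w t)).
Proof.
move=> van; split=> e /van[U U0 HU]; exists U => // t Ut; apply: le_lt_trans (HU t Ut).
  by rewrite /saddle_gap lerDl dot_ge0.
by rewrite /saddle_gap lerDr dot_ge0.
Qed.

(** A cluster point is approached at isolated times, whereas [prox_flow_no_gain] speaks of whole
    unit windows; settling extends closeness at [t] to the window that starts there. *)
Lemma saddle_flow_window (R : realType) (n m : nat) (K : set 'rV[R]_n) (V : set 'rV[R]_m)
    (L : 'rV[R]_n -> 'rV[R]_m -> R) (rho : R) (x z : R -> 'rV[R]_n) (y w : R -> 'rV[R]_m)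
    (xs : 'rV[R]_n) (ys : 'rV[R]_m) :
  saddle_flow K V L rho x z y w -> 0 < rho -> C1 L -> saddle_point K V L xs ys ->
  exists xb yb, forall r T : R, 0 < r -> exists2 t : R, T <= t &
    forall s, t <= s -> s <= t + 1 ->
      dot (x s - xb) (x s - xb) < r /\ dot (y s - yb) (y s - yb) < r.
Proof.
move=> fl rho0 cL sad; have van := saddle_gap_vanishes fl rho0 cL sad.
have [B HB] := saddle_flow_bounded fl rho0 sad.
have [xb [yb cl]] : exists xb yb, forall r T : R, 0 < r -> exists2 t : R, T <= t &
    dot (x t - xb) (x t - xb) < r /\ dot (y t - yb) (y t - yb) < r.
  apply: (@cluster_pair_pinfty R n m x y xs ys B) => t t0.
  have [] := HB t t0; rewrite /prox_energy.
  by have := dot_ge0 (z t - xs); have := dot_ge0 (w t - ys); split; lra.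
exists xb, yb => r T r0; have [fx fy] := fl.
(* The triangle bound gives 2 * (r / 8) + 2 * (r / 4) = 3r / 4 < r. *)
have r4 : 0 < r / 4 by rewrite divr_gt0.
have r8 : 0 < r / 8 by rewrite divr_gt0.
have [vx vy] := saddle_gap_vanishes2 van.
have [T1 T10 HT1] := prox_flow_primal_settles fx rho0 vx (fun t t0 => (HB t t0).1) r8.
have [T2 T20 HT2] := prox_flow_primal_settles fy rho0 vy (fun t t0 => (HB t t0).2) r8.
have [t] := cl (r / 4) (Num.max T (Num.max T1 T2)) r4.
rewrite !ge_max => /and3P[Tt T1t T2t] [hx hy].
exists t => // s ts st; split.
  by apply: le_lt_trans (sqdist_triangle _ (x t) _) _; have := HT1 t s T1t ts st; lra.
by apply: le_lt_trans (sqdist_triangle _ (y t) _) _; have := HT2 t s T2t ts st; lra.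
Qed.

Lemma saddle_flow_cluster_saddle (R : realType) (n m : nat) (K : set 'rV[R]_n) (V : set 'rV[R]_m)
    (L : 'rV[R]_n -> 'rV[R]_m -> R) (rho : R) (x z : R -> 'rV[R]_n) (y w : R -> 'rV[R]_m)
    (xs : 'rV[R]_n) (ys : 'rV[R]_m) :
  closed K -> closed V ->
  saddle_flow K V L rho x z y w -> 0 < rho -> C1 L -> saddle_point K V L xs ys ->
  exists xb yb, saddle_point K V L xb yb /\
    forall r T : R, 0 < r -> exists2 t : R, T <= t &
      dot (x t - xb) (x t - xb) < r /\ dot (y t - yb) (y t - yb) < r.
Proof.
move=> cK cV fl rho0 cL sad; have van := saddle_gap_vanishes fl rho0 cL sad.
have [xb [yb win]] := saddle_flow_window fl rho0 cL sad.
have rec r T : 0 < r -> exists2 t : R, T <= t &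
    dot (x t - xb) (x t - xb) < r /\ dot (y t - yb) (y t - yb) < r.
  by move=> r0; have [t Tt H] := win r T r0; exists t => //; apply: H; lra.
exists xb, yb; split=> //.
have [B HB] := saddle_flow_bounded fl rho0 sad.
have [vx vy] := saddle_gap_vanishes2 van.
have [fx fy] := fl; have [_ _ Kx _ _] := fx; have [_ _ Vy _ _] := fy.
have cF := C1_continuous cL.
have loc (F : 'rV[R]_n * 'rV[R]_m -> R) (e : R) : continuous F -> F (xb, yb) < e ->
    exists2 r : R, 0 < r & forall u v, dot (u - xb) (u - xb) < r ->
      dot (v - yb) (v - yb) < r -> F (u, v) < e.
  move=> cF' Fe; have : \forall q \near (xb, yb), F q < e by apply: (cvgr_lt _ (cF' (xb, yb))).
  move=> [[P Q] /= [/nbhs_sqdistP[r r0 hP] /nbhs_sqdistP[r' r0' hQ]] hPQ].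
  exists (Num.min r r'); first by rewrite lt_min r0.
  move=> u v; rewrite !lt_min => /andP[hu _] /andP[_ hv].
  by apply: (hPQ (u, v)); split; [exact: hP | exact: hQ].
split; [|split].
- apply: contrapT => nK.
  have /nbhs_sqdistP[r r0 hr] : nbhs xb (~` K).
    by apply: open_nbhs_nbhs; split => //; exact: closed_openC.
  by have [t t0 [hx _]] := rec r 0 r0; apply: (hr _ hx); exact: Kx.
- apply: contrapT => nV.
  have /nbhs_sqdistP[r r0 hr] : nbhs yb (~` V).
    by apply: open_nbhs_nbhs; split => //; exact: closed_openC.
  by have [t t0 [_ hy]] := rec r 0 r0; apply: (hr _ hy); exact: Vy.
move=> c d Kc Vd; split.
- rewrite leNgt; apply/negP => lt.
  (* Half of the gain at the cluster point: by continuity a gain of [eta] survives in a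
     neighbourhood, which contains entire windows at arbitrarily late times. *)
  pose eta := (L xb d - L xb yb) / 2.
  have eta0 : 0 < eta by rewrite divr_gt0 // subr_gt0.
  have [T T0 HT] := prox_flow_no_gain fy rho0 vy (fun t t0 => (HB t t0).2) Vd eta0.
  have [||r r0 Hr] := loc (fun q => L q.1 q.2 - L q.1 d) (- eta).
  + move=> [u v]; apply: cvgB; first exact: cF.
    apply: (continuous_comp (f := fun q : 'rV[R]_n * 'rV[R]_m => (q.1, d))
      (g := fun q => L q.1 q.2)); last exact: cF.
    by apply: (@cvg_pair _ _ _ (nbhs (u, v)) (nbhs u) (nbhs d) _ _ _ fst (fun=> d));
      [exact: cvg_fst | exact: cvg_cst].
  + rewrite /= /eta; lra.
  have [t Tt Hw] := win r T r0.
  apply: (HT t Tt) => s /andP[/ltW ts /ltW st]; have [hx hy] := Hw s ts st.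
  by have /= := Hr _ _ hx hy; lra.
- rewrite leNgt; apply/negP => lt.
  pose eta := (L xb yb - L c yb) / 2.
  have eta0 : 0 < eta by rewrite divr_gt0 // subr_gt0.
  have [T T0 HT] := prox_flow_no_gain fx rho0 vx (fun t t0 => (HB t t0).1) Kc eta0.
  have [||r r0 Hr] := loc (fun q => L c q.2 - L q.1 q.2) (- eta).
  + move=> [u v]; apply: cvgB; last exact: cF.
    apply: (continuous_comp (f := fun q : 'rV[R]_n * 'rV[R]_m => (c, q.2))
      (g := fun q => L q.1 q.2)); last exact: cF.
    by apply: (@cvg_pair _ _ _ (nbhs (u, v)) (nbhs c) (nbhs v) _ _ _ (fun=> c) snd);
      [exact: cvg_cst | exact: cvg_snd].
  + rewrite /= /eta; lra.
  have [t Tt Hw] := win r T r0.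
  apply: (HT t Tt) => s /andP[/ltW ts /ltW st]; have [hx hy] := Hw s ts st.
  by have /= := Hr _ _ hx hy; lra.
Qed.

(** * Convergence to a single saddle point *)

Lemma saddle_flow_energy_vanishes (R : realType) (n m : nat) (K : set 'rV[R]_n) (V : set 'rV[R]_m)
    (L : 'rV[R]_n -> 'rV[R]_m -> R) (rho : R) (x z : R -> 'rV[R]_n) (y w : R -> 'rV[R]_m)
    (xb : 'rV[R]_n) (yb : 'rV[R]_m) :
  saddle_flow K V L rho x z y w -> 0 < rho -> C1 L -> saddle_point K V L xb yb ->
  (forall r T : R, 0 < r -> exists2 t : R, T <= t &
     dot (x t - xb) (x t - xb) < r /\ dot (y t - yb) (y t - yb) < r) ->
  vanishes (saddle_energy x z y w xb yb).
Proof.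
move=> fl rho0 cL sad rec e e0.
(* Recurrence concerns x and y only; the gap brings z and w along. The energy is at most 3|x - xb|^2
   + 3|y - yb|^2 plus twice the gap, hence below [8 * (e / 12)]. *)
have e12 : 0 < e / 12 by rewrite divr_gt0.
have [T T0 HT] := saddle_gap_vanishes fl rho0 cL sad e12.
have [t Tt [hx hy]] := rec _ T e12; exists t; first exact: le_trans Tt.
move=> s ts; apply: le_lt_trans (saddle_energy_le fl rho0 sad (le_trans T0 Tt) ts) _.
have := HT t Tt; rewrite /saddle_gap /saddle_energy /prox_energy.
have := sqdist_triangle (z t) (x t) xb; have := sqdist_triangle (w t) (y t) yb.
rewrite (sqdistC (z t) (x t)) (sqdistC (w t) (y t)).
have := dot_ge0 (x t - z t); have := dot_ge0 (y t - w t).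
by lra.
Qed.

Lemma vanishes_sqdist_cvg (R : realType) (n : nat) (x : R -> 'rV[R]_n) (c : 'rV[R]_n) :
  vanishes (fun t => dot (x t - c) (x t - c)) -> x t @[t --> +oo] --> c.
Proof.
move=> van; apply/cvgrPdist_lt => e e0.
have [T _ HT] := van _ (exprn_gt0 2 e0).
exists T; split; first exact: num_real.
by move=> t /ltW Tt; rewrite distrC; apply: norm_lt_dot => //; exact: HT.
Qed.

Theorem theorem1 (R : realType) (n m : nat)
  (K : set 'rV[R]_n) (V : set 'rV[R]_m) (L : 'rV[R]_n -> 'rV[R]_m -> R)
  (rho : R) (x z : R -> 'rV[R]_n) (y w : R -> 'rV[R]_m) :
  closed K -> convex_set K -> closed V -> convex_set V ->
  C1 L ->
  (forall y0, convex_fun (fun x0 => L x0 y0)) ->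
  (forall x0, concave_fun (fun y0 => L x0 y0)) ->
  (exists xs ys, saddle_point K V L xs ys) ->
  0 < rho ->
  K (x 0) -> K (z 0) -> V (y 0) -> V (w 0) ->
  rsf_solution K V L rho x z y w ->
  (forall t, 0 <= t -> K (x t) /\ V (y t)) /\
  exists xs ys, saddle_point K V L xs ys /\
    x t @[t --> +oo] --> xs /\ y t @[t --> +oo] --> ys.
Proof.
move=> cK vK cV vV cL Lx Ly [xs [ys sad]] rho0 Kx0 Kz0 Vy0 Vw0 sol.
have fl := rsf_solution_saddle_flow cK vK cV vV cL Lx Ly Kx0 Kz0 Vy0 Vw0 sol.
split=> [t t0|].
  by have [[_ _ Kx _ _] [_ _ Vy _ _]] := fl; split; [exact: Kx | exact: Vy].
have [xb [yb [sadb rec]]] := saddle_flow_cluster_saddle cK cV fl rho0 cL sad.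
have van := saddle_flow_energy_vanishes fl rho0 cL sadb rec.
exists xb, yb; split=> //; split; apply: vanishes_sqdist_cvg => e /van[T T0 HT]; exists T => // t Tt;
  apply: le_lt_trans (HT t Tt); rewrite /saddle_energy /prox_energy.
  by have := dot_ge0 (z t - xb); have := dot_ge0 (y t - yb); have := dot_ge0 (w t - yb); lra.
by have := dot_ge0 (x t - xb); have := dot_ge0 (z t - xb); have := dot_ge0 (w t - yb); lra.
Qed.
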